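(* Up to isomorphism, the nilpotent Lie algebras of type $2$ and nilindex $t\le4$ are: a) $\mathfrak n_{2,t}$ for $t=1,2,3,4$; b) the quotient Lie algebras $\mathfrak n_{2,3}/I$, where $I$ is any $1$-dimensional subspace of $\mathfrak n_{2,3}^3=\mathrm{span}\langle z_0,z_1\rangle$; c) the quotient Lie algebras $\mathfrak n_{2,4}/I$, where $I$ is one of the following ideals: i) any $1$- or $2$-dimensional subspace of $\mathfrak n_{2,4}^4=\mathrm{span}\langle x_0,x_1,x_2\rangle$; ii) $I=\mathrm{span}\langle z_1+\alpha x_0,\,x_1,\,x_2\rangle$, $\alpha\in\mathbb C$; or iii) $I=\mathrm{span}\langle z_0+\alpha z_1+\beta x_2,\;2x_0+\alpha x_1,\;x_1+2\alpha x_2\rangle$, $\alpha,\beta\in\mathbb C$. Moreover, the algebras in this list that admit a nontrivial Levi extension are those given in item a).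
   Context: Lie algebras are finite-dimensional over $\mathbb C$ (except the free Lie algebra $\mathfrak{FL}_2$). For a Lie algebra $\mathfrak n$ put $\mathfrak n^1=\mathfrak n$, $\mathfrak n^{k+1}=[\mathfrak n,\mathfrak n^k]$. A nilpotent $\mathfrak n$ has nilindex $t$ if $\mathfrak n^t\neq0$ and $\mathfrak n^{t+1}=0$; its type is $\dim\mathfrak n-\dim\mathfrak n^2$. $\mathfrak n_{2,t}=\mathfrak{FL}_2/\mathfrak{FL}_2^{t+1}$ is the free nilpotent Lie algebra of type $2$ and nilindex $t$: $\mathfrak{FL}_2$ is the free Lie algebra on two generators and $\mathfrak{FL}_2^{t+1}$ is the ideal spanned by brackets of length at least $t+1$ in the generators. Explicit bases and nonzero products (up to skew-symmetry): $\mathfrak n_{2,1}$: basis $\{v_0,v_1\}$, abelian; $\mathfrak n_{2,2}$: basis $\{v_0,v_1,w_0\}$, $[v_0,v_1]=w_0$; $\mathfrak n_{2,3}$: basis $\{v_0,v_1,w_0,z_0,z_1\}$, $[v_0,v_1]=w_0$, $[v_0,w_0]=z_0$, $[v_1,w_0]=z_1$; $\mathfrak n_{2,4}$: basis $\{v_0,v_1,w_0,z_0,z_1,x_0,x_1,x_2\}$, $[v_0,v_1]=w_0$, $[v_0,w_0]=z_0$, $[v_1,w_0]=z_1$, $[v_0,z_0]=x_0$, $[v_0,z_1]=[v_1,z_0]=\tfrac12x_1$, $[v_1,z_1]=x_2$. A nilpotent Lie algebra $\mathfrak n$ admits a nontrivial Levi extension if there is a Lie algebra with solvable radical $\mathfrak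 n$ and a Levi subalgebra $\mathfrak s$ with $[\mathfrak s,\mathfrak n]\neq0$. *)

(* Defs.v *)
From HB Require Import structures.
From mathcomp Require Import all_boot all_order all_algebra.
From mathcomp Require Import boolp reals.
From mathcomp Require Import complex.

Set Implicit Arguments.
Unset Strict Implicit.
Unset Printing Implicit Defensive.

Import GRing.Theory.
Local Open Scope ring_scope.
Local Open Scope quotient_scope.

HB.mixin Record Lmodule_isLie (F : fieldType) L of GRing.Lmodule F L := {
  lie : L -> L -> L;
  lie_linearl : forall z, linear (lie^~ z);
  lie_linearr : forall z, linear (lie z);
  liexx : forall x, lie x x = 0;
  lie_jacobi : forall x y z,
    lie x (lie y z) + lie y (lie z x) + lie z (lie x y) = 0 }.

#[short(type="lieType")]
HB.structure Definition Lie (F : fieldType) :=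
  {L of GRing.Lmodule F L & Lmodule_isLie F L}.

#[short(type="vectLieType")]
HB.structure Definition VectLie (F : fieldType) :=
  {L of Vector F L & Lie F L}.

HB.instance Definition _ (F : fieldType) (L : lieType F) (z : L) :=
  GRing.isLinear.Build F L L *:%R (lie z) (lie_linearr z).

Section LieTheory.
Variables (F : fieldType) (L : lieType F).
Implicit Types x y z : L.

Let lier z : {linear L -> L} :=
  HB.pack (lie^~ z) (GRing.isLinear.Build F L L *:%R (lie^~ z) (lie_linearl z)).

Lemma lieDr x y z : lie x (y + z) = lie x y + lie x z.
Proof. exact: raddfD. Qed.
Lemma lieDl x y z : lie (x + y) z = lie x z + lie y z.
Proof. exact: (raddfD (lier z)). Qed.
Lemma lieBr x y z : lie x (y - z) = lie x y - lie x z.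
Proof. exact: raddfB. Qed.
Lemma lieBl x y z : lie (x - y) z = lie x z - lie y z.
Proof. exact: (raddfB (lier z)). Qed.
Lemma lieNr x y : lie x (- y) = - lie x y.
Proof. exact: raddfN. Qed.
Lemma lieNl x y : lie (- x) y = - lie x y.
Proof. exact: (raddfN (lier y)). Qed.
Lemma lie0r x : lie x 0 = 0.
Proof. exact: raddf0. Qed.
Lemma lie0l x : lie 0 x = 0.
Proof. exact: (raddf0 (lier x)). Qed.
Lemma lieZr a x y : lie x (a *: y) = a *: lie x y.
Proof. exact: linearZ. Qed.
Lemma lieZl a x y : lie (a *: x) y = a *: lie x y.
Proof. exact: (linearZ_LR (lier y)). Qed.

Lemma lieC x y : lie x y = - lie y x.
Proof.
apply/eqP; rewrite -addr_eq0; have := liexx (x + y).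
by rewrite lieDr !lieDl !liexx add0r addr0 addrC => ->.
Qed.

Lemma lie_leibniz x y z :
  lie x (lie y z) = lie (lie x y) z + lie y (lie x z).
Proof.
apply/eqP; rewrite -subr_eq0 (lieC (lie x y) z) (lieC x z) lieNr opprD !opprK.
by rewrite [X in _ + X]addrC addrA lie_jacobi.
Qed.

End LieTheory.

Definition lie_morph (F : fieldType) (L M : lieType F) (f : L -> M) :=
  {morph f : x y / lie x y}.

Definition lie_iso (F : fieldType) (L M : lieType F) :=
  exists2 f : {linear L -> M}, bijective f & lie_morph f.

Section FiniteDim.
Variables (F : fieldType) (L : vectLieType F).
Implicit Types U V I J S r s : {vspace L}.

(* The subspace spanned by all the brackets of an element of U and one of V. *)
Definition lie_prod U V : {vspace L} :=
  <<[seq lie u v | u <- vbasis U, v <- vbasis V]>>%VS.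

(* The lower central series is indexed from 1: lcs 1 = L (also lcs 0 = L). *)
Definition lcs k : {vspace L} := iter k.-1 (lie_prod fullv) fullv.

Definition nilindex t := (lcs t != 0%VS) && (lcs t.+1 == 0%VS).

Definition nil_type := (\dim {:L} - \dim (lcs 2))%N.

Definition is_ideal I := (lie_prod fullv I <= I)%VS.

Definition is_subalgebra S := (lie_prod S S <= S)%VS.

Definition solvable U := exists k, iter k (fun W => lie_prod W W) U = 0%VS.

Definition is_radical r :=
  [/\ is_ideal r, solvable r
    & forall J, is_ideal J -> solvable J -> (J <= r)%VS].

(* S, seen as a Lie algebra, has no nonzero solvable ideal. *)
Definition semisimple S :=
  forall J, (J <= S)%VS -> (lie_prod S J <= J)%VS -> solvable J -> J = 0%VS.

(* Here r is meant to be the solvable radical of L. *)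
Definition is_levi r S :=
  [/\ is_subalgebra S, semisimple S, (S + r = fullv)%VS & (S :&: r = 0)%VS].

End FiniteDim.

Arguments lcs {F} L k.
Arguments nilindex {F} L t.
Arguments nil_type {F} L.

(* f identifies n with the solvable radical of g. *)
Definition nontrivial_levi_ext (F : fieldType) (n : vectLieType F) :=
  exists (g : vectLieType F) (f : {linear n -> g}),
    [/\ injective f, lie_morph f, is_radical (limg (linfun f))
      & exists2 s : {vspace g}, is_levi (limg (linfun f)) s
                              & lie_prod s (limg (linfun f)) != 0%VS].

Record lieIdeal (F : fieldType) (L : lieType F) := LieIdeal {
  lie_ideal_pred :> {pred L};
  lie_ideal_submod : submod_closed lie_ideal_pred;
  lie_idealP : forall x y, y \in lie_ideal_pred -> lie x y \in lie_ideal_pred }.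

HB.instance Definition _ (F : fieldType) (L : lieType F) (I : lieIdeal L) :=
  GRing.isSubmodClosed.Build F L (lie_ideal_pred I) (lie_ideal_submod I).

Section LieQuotient.
Variables (F : fieldType) (L : lieType F) (I : lieIdeal L).

Definition lie_quot := Quotient.quot (GRing.ZmodClosed.clone L (lie_ideal_pred I) _).
HB.instance Definition _ := Choice.on lie_quot.
HB.instance Definition _ := GRing.Zmodule.on lie_quot.
HB.instance Definition _ := EqQuotient.on lie_quot.

Definition lie_proj (x : L) : lie_quot := \pi_lie_quot x.

Lemma lie_projP x y : reflect (lie_proj x = lie_proj y) (x - y \in I).
Proof. by rewrite Quotient.idealrBE; apply: eqP. Qed.

Fact lie_projB : {morph lie_proj : x y / x - y}.
Proof. exact: (raddfB \pi_(Quotient.quot (GRing.ZmodClosed.clone L (lie_ideal_pred I) _))). Qed.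
Fact lie_projD : {morph lie_proj : x y / x + y}.
Proof. exact: (raddfD \pi_(Quotient.quot (GRing.ZmodClosed.clone L (lie_ideal_pred I) _))). Qed.

Fact lie_proj_ind (P : lie_quot -> Prop) :
  (forall x, P (lie_proj x)) -> forall u, P u.
Proof. by move=> h u; rewrite -[u]reprK; apply: h. Qed.

Definition lquot_scale (a : F) (u : lie_quot) := lie_proj (a *: repr u).
Definition lquot_lie (u v : lie_quot) := lie_proj (lie (repr u) (repr v)).

Fact lie_reprE x : repr (lie_proj x) - x \in I.
Proof. by apply/lie_projP; rewrite /lie_proj reprK. Qed.

Fact lquot_scaleE a x : lquot_scale a (lie_proj x) = lie_proj (a *: x).
Proof. by apply/lie_projP; rewrite -scalerBr rpredZ ?lie_reprE. Qed.

Fact lquot_lieE x y : lquot_lie (lie_proj x) (lie_proj y) = lie_proj (lie x y).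
Proof.
apply/lie_projP; set x' := repr _; set y' := repr _.
have -> : lie x' y' - lie x y = lie x' (y' - y) - lie y (x' - x).
  rewrite !lieBr (lieC y x') (lieC y x); set a := lie x' y'.
  by rewrite opprK opprD opprK addrA addrNK.
by rewrite rpredB ?lie_idealP ?lie_reprE.
Qed.

Fact lquot_scaleA a b u : lquot_scale a (lquot_scale b u) = lquot_scale (a * b) u.
Proof. by elim/lie_proj_ind: u => x; rewrite !lquot_scaleE scalerA. Qed.
Fact lquot_scale1 : left_id 1 lquot_scale.
Proof. by elim/lie_proj_ind => x; rewrite lquot_scaleE scale1r. Qed.
Fact lquot_scaleDr : right_distributive lquot_scale +%R.
Proof.
move=> a; elim/lie_proj_ind => x; elim/lie_proj_ind => y.
by rewrite -lie_projD !lquot_scaleE scalerDr lie_projD.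
Qed.
Fact lquot_scaleDl u : {morph lquot_scale^~ u : a b / a + b}.
Proof.
by elim/lie_proj_ind: u => x a b; rewrite !lquot_scaleE scalerDl lie_projD.
Qed.

HB.instance Definition _ := GRing.Zmodule_isLmodule.Build F lie_quot
  lquot_scaleA lquot_scale1 lquot_scaleDr lquot_scaleDl.

Fact lie_proj_linear : linear lie_proj.
Proof. by move=> a x y; rewrite lie_projD -lquot_scaleE. Qed.
HB.instance Definition _ :=
  GRing.isLinear.Build F L lie_quot *:%R lie_proj lie_proj_linear.

Fact lquot_linearl w : linear (lquot_lie^~ w).
Proof.
elim/lie_proj_ind: w => z a; elim/lie_proj_ind => x; elim/lie_proj_ind => y.
by rewrite -linearP !lquot_lieE -linearP lie_linearl.
Qed.
Fact lquot_linearr w : linear (lquot_lie w).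
Proof.
elim/lie_proj_ind: w => z a; elim/lie_proj_ind => x; elim/lie_proj_ind => y.
by rewrite -linearP !lquot_lieE -linearP lie_linearr.
Qed.
Fact lquot_liexx u : lquot_lie u u = 0.
Proof. by elim/lie_proj_ind: u => x; rewrite lquot_lieE liexx linear0. Qed.
Fact lquot_jacobi u v w :
  lquot_lie u (lquot_lie v w) + lquot_lie v (lquot_lie w u)
  + lquot_lie w (lquot_lie u v) = 0.
Proof.
elim/lie_proj_ind: u => x; elim/lie_proj_ind: v => y; elim/lie_proj_ind: w => z.
by rewrite !lquot_lieE -!linearD lie_jacobi linear0.
Qed.
HB.instance Definition _ := Lmodule_isLie.Build F lie_quot
  lquot_linearl lquot_linearr lquot_liexx lquot_jacobi.

Lemma lie_proj_morph : lie_morph lie_proj.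
Proof. by move=> x y; symmetry; apply: lquot_lieE. Qed.

Lemma lie_proj_eq0 x : (lie_proj x == 0) = (x \in I).
Proof.
rewrite -(linear0 lie_proj) -[x in RHS]subr0.
exact: (sameP eqP (lie_projP _ _)).
Qed.

End LieQuotient.

Section Span.
Variables (F : fieldType) (V : lmodType F).
Implicit Types (A : V -> Prop) (x y : V).

Inductive lspan A : V -> Prop :=
| lspan0 : lspan A 0
| lspanP a x y : A x -> lspan A y -> lspan A (a *: x + y).

Lemma lspan_in A x : A x -> lspan A x.
Proof. by move=> Ax; rewrite -[x]addr0 -[x]scale1r; apply: lspanP (lspan0 A). Qed.

Lemma lspanL A a x y : lspan A x -> lspan A y -> lspan A (a *: x + y).
Proof.
move=> Ax Ay; elim: Ax => [|b u v Au _ IH]; first by rewrite scaler0 add0r.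
by rewrite scalerDr scalerA -addrA; apply: lspanP.
Qed.

Lemma lspanD A x y : lspan A x -> lspan A y -> lspan A (x + y).
Proof. by move=> Ax Ay; rewrite -[x]scale1r; apply: lspanL. Qed.

Lemma lspanZ A a x : lspan A x -> lspan A (a *: x).
Proof. by move=> Ax; rewrite -[_ *: _]addr0; apply: lspanL (lspan0 A). Qed.

Lemma lspan_mono A B x : (forall y, A y -> B y) -> lspan A x -> lspan B x.
Proof.
move=> AB; elim=> [|a u v Au _ IH]; first exact: lspan0.
by apply: lspanP (AB _ Au) IH.
Qed.

Lemma lspan_seq (s : seq V) x : lspan (fun y => y \in s) x ->
  exists r : 'rV[F]_(size s), x = \sum_i r 0 i *: s`_i.
Proof.
elim=> [|a u v us _ [r ->]].
  by exists 0; rewrite big1 // => i _; rewrite mxE scale0r.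
have us' : (index u s < size s)%N by rewrite index_mem.
exists (a *: delta_mx 0 (Ordinal us') + r).
under [RHS]eq_bigr do rewrite !mxE scalerDl -scalerA.
rewrite big_split /= -scaler_sumr; congr (a *: _ + _).
rewrite (bigD1 (Ordinal us')) //= eqxx scale1r nth_index // big1 ?addr0 //.
by move=> i /negPf ni; rewrite ni scale0r.
Qed.

Lemma fin_span_vect :
  (exists s : seq V, forall x, lspan (fun y => y \in s) x) ->
  {n & Vector.axiom n V}.
Proof.
move=> fs.
pose comb n (e : 'I_n -> V) (r : 'rV[F]_n) := \sum_i r 0 i *: e i.
pose P n := `[< exists e : 'I_n -> V, forall x, exists r, x = comb n e r >].
have exP : exists n, P n.
  have [s ss] := fs; exists (size s); apply/asboolP.
  by exists (fun i => s`_i) => x; apply: lspan_seq.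
have drop n (e : 'I_n.+1 -> V) (r : 'rV_n.+1) i :
    (forall x, exists r, x = comb _ e r) -> comb _ e r = 0 -> r 0 i != 0 -> P n.
  move=> es r0 ri; apply/asboolP; exists (fun j => e (lift i j)) => x.
  have [a ->] := es x.
  exists (\row_j (a 0 (lift i j) - a 0 i / r 0 i * r 0 (lift i j))).
  rewrite -[LHS]subr0 -(scaler0 V (a 0 i / r 0 i)) -r0 /comb scaler_sumr -sumrB.
  rewrite (bigD1_ord i) //= scalerA divfK // subrr add0r.
  by apply: eq_bigr => j _; rewrite !mxE scalerA -scalerBl.
case: (ex_minnP exP) => n /asboolP/cid[e es] minn; exists n.
have comb_lin a r1 r2 : comb n e (a *: r1 + r2) = a *: comb n e r1 + comb n e r2.
  rewrite /comb scaler_sumr -big_split /=; apply: eq_bigr => i _.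
  by rewrite !mxE scalerDl scalerA.
have comb_inj r : comb n e r = 0 -> r = 0.
  move=> r0; apply/rowP => i; rewrite mxE; apply/eqP/contraT => ri.
  case: n e es minn r r0 i ri {comb_lin} => [|n] e es minn r r0 i ri.
    by case: i ri.
  by have := minn _ (drop _ _ _ _ es r0 ri); rewrite ltnn.
have inj r1 r2 : comb n e r1 = comb n e r2 -> r1 = r2.
  move=> e12; apply/eqP; rewrite -subr_eq0; apply/eqP/comb_inj.
  by rewrite addrC -scaleN1r comb_lin e12 scaleN1r addNr.
have [f fE] := choice es.
exists f; first by move=> a x y; apply: inj; rewrite comb_lin -!fE.
by exists (comb n e) => [x|r]; [rewrite -fE | apply: inj; rewrite -fE].
Qed.

End Span.

Section VectQuotient.
Variables (F : fieldType) (L : vectLieType F) (I : lieIdeal L).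

Lemma lie_quot_fin_span :
  exists s : seq (lie_quot I), forall u, lspan (fun v => v \in s) u.
Proof.
exists (map (lie_proj I) (vbasis {:L})); elim/lie_proj_ind => x.
rewrite (coord_vbasis (memvf x)) linear_sum /=.
elim/big_ind: _ => [|u v|i _]; [exact: lspan0|exact: lspanD|].
rewrite linearZ; apply/lspanZ/lspan_in/map_f.
by apply: mem_nth; rewrite size_tuple.
Qed.

HB.instance Definition _ := Lmodule_hasFinDim.Build F (lie_quot I)
  (projT2 (fin_span_vect lie_quot_fin_span)).

End VectQuotient.

Section SubspaceIdeal.
Variables (F : fieldType) (L : vectLieType F) (I : {vspace L}).
Hypothesis idI : is_ideal I.

Fact vs_ideal_subproof x y : y \in I -> lie x y \in I.
Proof.
move=> yI; apply: (subvP idI).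
rewrite (coord_vbasis (memvf x)) (coord_vbasis yI).
set u := \sum_i _; have lin z : lie u z = - lie z u by rewrite lieC.
rewrite linear_sum memv_suml // => j _; rewrite linearZ memvZ //= lin rpredN.
rewrite linear_sum memv_suml // => i _; rewrite linearZ memvZ //= lieC rpredN.
apply: memv_span; apply/allpairsP.
exists ((vbasis {:L})`_i, (vbasis I)`_j) => /=.
by split=> //; apply: mem_nth; rewrite size_tuple.
Qed.

Definition vs_ideal : lieIdeal L :=
  LieIdeal (lie_ideal_pred := fun x => x \in I)
    (memv_submod_closed I) vs_ideal_subproof.

End SubspaceIdeal.

(* The same series as lcs, without assuming finite dimension: lcs_set 1 = L and
   lcs_set k.+1 is spanned by the brackets [x, y] with y in lcs_set k. *)
Section LowerCentral.
Variables (F : fieldType) (L : lieType F).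
Implicit Types x y : L.

Definition lcs_set k : L -> Prop :=
  iter k.-1 (fun A => lspan (fun z => exists x y, A y /\ z = lie x y)) (fun=> True).

Lemma lcs_set_lie k x y : lcs_set k.+1 y -> lcs_set k.+2 (lie x y).
Proof. by move=> ky; apply: lspan_in; exists x, y. Qed.

Lemma lcs_setL k a x y :
  lcs_set k x -> lcs_set k y -> lcs_set k (a *: x + y).
Proof. by case: k => [|[|k]] //; apply: lspanL. Qed.

Lemma lcs_set0 k : lcs_set k 0.
Proof. by case: k => [|[|k]] //; apply: lspan0. Qed.

Lemma lcs_setS k x : lcs_set k.+1 x -> lcs_set k x.
Proof.
case: k => // k; elim: k x => // k IH x; apply: lspan_mono => z [u [v [kv ->]]].
by exists u, v; split=> //; apply: IH.
Qed.

Fact lcs_set_ideal k x y : lcs_set k y -> lcs_set k (lie x y).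
Proof. by case: k => // k ky; apply: lcs_setS; apply: lcs_set_lie. Qed.

Definition lcs_pred k : L -> bool := fun x => `[< lcs_set k x >].

Fact lcs_pred_submod k : submod_closed (lcs_pred k).
Proof.
split=> [|a x y /asboolP kx /asboolP ky]; apply/asboolP; first exact: lcs_set0.
exact: lcs_setL.
Qed.

Fact lcs_pred_ideal k x y : y \in lcs_pred k -> lie x y \in lcs_pred k.
Proof. by move=> /asboolP ky; apply/asboolP; apply: lcs_set_ideal. Qed.

Definition lcs_ideal k : lieIdeal L :=
  LieIdeal (lcs_pred_submod k) (@lcs_pred_ideal k).

Lemma lcs_set2_lie k x y :
  lcs_set 2 x -> lcs_set k.+1 y -> lcs_set k.+3 (lie x y).
Proof.
move=> x2 ky; elim: x2 => [|a u v [p [q [_ ->]]] _ IH].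
  by rewrite lie0l; apply: lcs_set0.
rewrite lieDl lieZl; apply: lcs_setL IH.
have -> : lie (lie p q) y = -1 *: lie q (lie p y) + lie p (lie q y).
  by rewrite scaleN1r (lie_leibniz p) addrC addrK.
by apply: lcs_setL; do 2![apply: lcs_set_lie].
Qed.

Lemma lcs_set_span (gens : seq L) :
  (forall x, exists2 y, lspan (fun g => g \in gens) y & lcs_set 2 (x - y)) ->
  forall t, exists s : seq L, forall x,
    exists2 y, lspan (fun g => g \in s) y & lcs_set t.+1 (x - y).
Proof.
move=> gensP t.
have layer k : exists s : seq L, forall x, lcs_set k.+1 x ->
    exists2 y, lspan (fun g => g \in s) y & lcs_set k.+2 (x - y).
  elim: k => [|k [s sP]]; first by exists gens => x _; apply: gensP.
  exists [seq lie g m | g <- gens, m <- s] => x.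
  elim=> [|a _ x' [u [v [kv ->]]] _ [y' ys' xy']].
    by exists 0; [apply: lspan0 | rewrite subr0; apply: lcs_set0].
  have [g gg ug] := gensP u; have [m ms vm] := sP _ kv.
  exists (a *: lie g m + y').
    apply: lspanL ys'; elim: gg {ug} => [|b g1 g2 g1g _ IH].
      by rewrite lie0l; apply: lspan0.
    rewrite lieDl lieZl; apply: lspanL IH.
    elim: ms {vm} => [|c m1 m2 m1s _ IH]; first by rewrite lie0r; apply: lspan0.
    rewrite lieDr lieZr; apply: lspanP IH.
    by apply/allpairsP; exists (g1, m1).
  rewrite opprD addrACA -scalerBr; apply: lcs_setL xy'.
  have -> : lie u v - lie g m = 1 *: lie (u - g) v + lie g (v - m).
    by rewrite scale1r lieBl lieBr addrA addrNK.
  by apply: lcs_setL; [apply: lcs_set2_lie | apply: lcs_set_lie].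
elim: t => [|t [s sP]].
  by exists [::] => x; exists 0; [apply: lspan0|].
have [s' s'P] := layer t; exists (s ++ s') => x.
have [y ys /s'P[y' ys' xy]] := sP x; exists (y + y'); last by rewrite opprD addrA.
by apply: lspanD; [move: ys | move: ys']; apply: lspan_mono => z zs;
  rewrite mem_cat zs ?orbT.
Qed.

End LowerCentral.

Arguments lcs_ideal {F} L k.

(* The free Lie algebra on X over F: Lie polynomials in the letters of X,
   two of them being identified when all Lie algebras satisfy their equality. *)

Inductive lie_term (F X : Type) :=
| LTgen of X
| LTzero
| LTadd of lie_term F X & lie_term F X
| LTscale of F & lie_term F X
| LTlie of lie_term F X & lie_term F X.

Arguments LTgen {F X}.
Arguments LTzero {F X}.

HB.instance Definition _ (F X : Type) := gen_eqMixin (lie_term F X).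
HB.instance Definition _ (F X : Type) := gen_choiceMixin (lie_term F X).

Section FreeLie.
Variables (F : fieldType) (X : Type).
Implicit Types t : lie_term F X.

Fixpoint lt_eval (L : lieType F) (f : X -> L) t : L :=
  match t with
  | LTgen x => f x
  | LTzero => 0
  | LTadd t1 t2 => lt_eval f t1 + lt_eval f t2
  | LTscale a t1 => a *: lt_eval f t1
  | LTlie t1 t2 => lie (lt_eval f t1) (lt_eval f t2)
  end.

Definition lt_equiv t1 t2 :=
  `[< forall (L : lieType F) (f : X -> L), lt_eval f t1 = lt_eval f t2 >].

Fact lt_equiv_class : equiv_class_of lt_equiv.
Proof.
split=> [t|t1 t2|t1 t2 t3]; first exact/asboolP.
  by apply/asboolP/asboolP => e L f; rewrite e.
by move=> /asboolP e /asboolP e'; apply/asboolP => L f; rewrite e.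
Qed.

Canonical lt_equiv_equiv := EquivRelPack lt_equiv_class.
Canonical lt_equiv_encModRel := defaultEncModRel lt_equiv.

Definition freeLie := {eq_quot lt_equiv}.
HB.instance Definition _ := Choice.on freeLie.
HB.instance Definition _ := EqQuotient.on freeLie.

Definition fl_class t : freeLie := \pi_freeLie t.

Definition fl_gen (x : X) : freeLie := fl_class (LTgen x).

Lemma fl_classP t1 t2 :
  fl_class t1 = fl_class t2 <->
  forall (L : lieType F) (f : X -> L), lt_eval f t1 = lt_eval f t2.
Proof. by split=> [/eqquotP/asboolP | e]; last exact/eqquotP/asboolP. Qed.

Fact fl_class_ind (P : freeLie -> Prop) : (forall t, P (fl_class t)) -> forall u, P u.
Proof. by move=> h u; rewrite -[u]reprK; apply: h. Qed.

Lemma lt_eval_repr (L : lieType F) (f : X -> L) t :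
  lt_eval f (repr (fl_class t)) = lt_eval f t.
Proof. by move: L f; apply/fl_classP; apply: reprK. Qed.

Definition fl_add (u v : freeLie) := fl_class (LTadd (repr u) (repr v)).
Definition fl_scale a (u : freeLie) := fl_class (LTscale a (repr u)).
Definition fl_opp := fl_scale (-1).
Definition fl_lie (u v : freeLie) := fl_class (LTlie (repr u) (repr v)).

Fact fl_addA : associative fl_add.
Proof. by move=> u v w; apply/fl_classP => L f /=; rewrite !lt_eval_repr /= addrA. Qed.
Fact fl_addC : commutative fl_add.
Proof. by move=> u v; apply/fl_classP => L f /=; rewrite addrC. Qed.
Fact fl_add0 : left_id (fl_class LTzero) fl_add.
Proof.
by elim/fl_class_ind=> t; apply/fl_classP => L f /=; rewrite !lt_eval_repr add0r.
Qed.
Fact fl_addN : left_inverse (fl_class LTzero) fl_opp fl_add.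
Proof.
by move=> u; apply/fl_classP => L f /=; rewrite lt_eval_repr /= scaleN1r addNr.
Qed.
HB.instance Definition _ :=
  GRing.isZmodule.Build freeLie fl_addA fl_addC fl_add0 fl_addN.

Fact fl_scaleA a b u : fl_scale a (fl_scale b u) = fl_scale (a * b) u.
Proof. by apply/fl_classP => L f /=; rewrite lt_eval_repr /= scalerA. Qed.
Fact fl_scale1 : left_id 1 fl_scale.
Proof.
by elim/fl_class_ind=> t; apply/fl_classP => L f /=; rewrite lt_eval_repr scale1r.
Qed.
Fact fl_scaleDr : right_distributive fl_scale +%R.
Proof.
by move=> a u v; apply/fl_classP => L f /=; rewrite !lt_eval_repr /= scalerDr.
Qed.
Fact fl_scaleDl u : {morph fl_scale^~ u : a b / a + b}.
Proof.
by move=> a b; apply/fl_classP => L f /=; rewrite !lt_eval_repr /= scalerDl.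
Qed.
HB.instance Definition _ := GRing.Zmodule_isLmodule.Build F freeLie
  fl_scaleA fl_scale1 fl_scaleDr fl_scaleDl.

Fact fl_linearl w : linear (fl_lie^~ w).
Proof.
move=> a u v; apply/fl_classP => L f /=.
by rewrite !lt_eval_repr /= !lt_eval_repr /= lieDl lieZl.
Qed.
Fact fl_linearr w : linear (fl_lie w).
Proof.
move=> a u v; apply/fl_classP => L f /=.
by rewrite !lt_eval_repr /= !lt_eval_repr /= lieDr lieZr.
Qed.
Fact fl_liexx u : fl_lie u u = 0.
Proof. by apply/fl_classP => L f /=; rewrite liexx. Qed.
Fact fl_jacobi u v w :
  fl_lie u (fl_lie v w) + fl_lie v (fl_lie w u) + fl_lie w (fl_lie u v) = 0.
Proof.
apply/fl_classP => L f /=.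
by do 3!rewrite !lt_eval_repr /=; rewrite lie_jacobi.
Qed.
HB.instance Definition _ := Lmodule_isLie.Build F freeLie
  fl_linearl fl_linearr fl_liexx fl_jacobi.

Fact fl_class0 : fl_class LTzero = 0. Proof. by []. Qed.
Fact fl_classD t1 t2 : fl_class (LTadd t1 t2) = fl_class t1 + fl_class t2.
Proof. by apply/fl_classP => L f /=; rewrite !lt_eval_repr. Qed.
Fact fl_classZ a t : fl_class (LTscale a t) = a *: fl_class t.
Proof. by apply/fl_classP => L f /=; rewrite !lt_eval_repr. Qed.
Fact fl_class_lie t1 t2 : fl_class (LTlie t1 t2) = lie (fl_class t1) (fl_class t2).
Proof. by apply/fl_classP => L f /=; rewrite !lt_eval_repr. Qed.

Lemma freeLie_ind (P : freeLie -> Prop) :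
  (forall x, P (fl_gen x)) -> P 0 -> (forall u v, P u -> P v -> P (u + v)) ->
  (forall a u, P u -> P (a *: u)) -> (forall u v, P u -> P v -> P (lie u v)) ->
  forall u, P u.
Proof.
move=> Pg P0 PD PZ Pl; elim/fl_class_ind; elim=> [x||t1 ? t2 ?|a t ?|t1 ? t2 ?].
- exact: Pg.
- exact: P0.
- by rewrite fl_classD; apply: PD.
- by rewrite fl_classZ; apply: PZ.
- by rewrite fl_class_lie; apply: Pl.
Qed.

Lemma freeLie_lift (L : lieType F) (f : X -> L) :
  exists2 h : {linear freeLie -> L}, lie_morph h & forall x, h (fl_gen x) = f x.
Proof.
pose h (u : freeLie) := lt_eval f (repr u).
have hlin : linear h by move=> a u v; rewrite /h !lt_eval_repr /= lt_eval_repr.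
pose hL : {linear freeLie -> L} :=
  HB.pack h (GRing.isLinear.Build F freeLie L *:%R h hlin).
exists hL => [u v|x] /=.
  by rewrite /h lt_eval_repr.
by rewrite /h lt_eval_repr.
Qed.

Lemma freeLie_lift_unique (L : lieType F) (h h' : {linear freeLie -> L}) :
  lie_morph h -> lie_morph h' -> (forall x, h (fl_gen x) = h' (fl_gen x)) -> h =1 h'.
Proof.
move=> hm h'm e; elim/freeLie_ind => // [|u v hu hv|a u hu|u v hu hv].
- by rewrite !linear0.
- by rewrite !linearD hu hv.
- by rewrite !linearZ hu.
- by rewrite hm h'm hu hv.
Qed.

End FreeLie.

Section FreeNilpotent.
Variables (F : fieldType) (X : finType) (t : nat).

Definition freeNil := lie_quot (lcs_ideal (freeLie F X) t.+1).
HB.instance Definition _ := Lie.on freeNil.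

Lemma freeNil_fin_span :
  exists s : seq freeNil, forall u, lspan (fun v => v \in s) u.
Proof.
have [x|s sP] := @lcs_set_span F (freeLie F X) (map (@fl_gen F X) (enum X)) _ t.
  elim/freeLie_ind: x => [x||u v [y yg uy] [z zg vz]|a u [y yg uy]|u v _ _].
  - exists (fl_gen F x); last by rewrite subrr; apply: lcs_set0.
    by apply/lspan_in/map_f; rewrite mem_enum.
  - by exists 0; [apply: lspan0 | rewrite subr0; apply: lcs_set0].
  - exists (y + z); first exact: lspanD.
    by rewrite opprD addrACA -[X in X + _]scale1r; apply: lcs_setL.
  - exists (a *: y); first exact: lspanZ.
    by rewrite -scalerBr -[_ *: _]addr0; apply: lcs_setL (lcs_set0 _ _).
  - exists 0; first exact: lspan0.
    by rewrite subr0; apply: lcs_set_lie.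
exists (map (lie_proj (lcs_ideal (freeLie F X) t.+1)) s).
elim/lie_proj_ind => x; have [y ys xy] := sP x.
have -> : lie_proj (lcs_ideal _ t.+1) x = lie_proj _ y by apply/lie_projP/asboolP.
elim: ys {xy} => [|a u v us _ IH]; first by rewrite linear0; apply: lspan0.
by rewrite linearP; apply: lspanP IH; apply: map_f.
Qed.

HB.instance Definition _ := Lmodule_hasFinDim.Build F freeNil
  (projT2 (fin_span_vect freeNil_fin_span)).

Definition fn_gen (x : X) : freeNil := lie_proj _ (fl_gen F x).

End FreeNilpotent.

Arguments fn_gen {F X t} x.

Definition n2 (F : fieldType) (t : nat) : vectLieType F := freeNil F 'I_2 t.

(* In n_{2,t} the bases for t <= 4 consist of iterated brackets of the two
   generators; the factor in x1 comes from [v0, z1] = [v1, z0] = x1 / 2. *)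
Section N2Elements.
Variables (F : fieldType) (t : nat).

Definition v0 : n2 F t := fn_gen ord0.
Definition v1 : n2 F t := fn_gen ord_max.
Definition w0 : n2 F t := lie v0 v1.
Definition z0 : n2 F t := lie v0 w0.
Definition z1 : n2 F t := lie v1 w0.
Definition x0 : n2 F t := lie v0 z0.
Definition x1 : n2 F t := 2 *: lie v0 z1.
Definition x2 : n2 F t := lie v1 z1.

Lemma lie_v1_z0 : lie v1 z0 = lie v0 z1.
Proof. by rewrite /z1 [RHS]lie_leibniz liexx add0r. Qed.

End N2Elements.

Arguments v0 {F t}.
Arguments v1 {F t}.
Arguments w0 {F t}.
Arguments z0 {F t}.
Arguments z1 {F t}.
Arguments x0 {F t}.
Arguments x1 {F t}.
Arguments x2 {F t}.

Section List.
Variable F : fieldType.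

Definition ideal_b (I : {vspace n2 F 3}) := (I <= lcs _ 3)%VS /\ \dim I = 1%N.

Variant ideal_c (I : {vspace n2 F 4}) : Prop :=
| Ideal_c_i of (I <= lcs _ 4)%VS & \dim I = 1%N \/ \dim I = 2%N
| Ideal_c_ii (alpha : F) of I = span [:: z1 + alpha *: x0; x1; x2]
| Ideal_c_iii (alpha beta : F) of
    I = span [:: z0 + alpha *: z1 + beta *: x2; 2 *: x0 + alpha *: x1;
                 x1 + (2 * alpha) *: x2].

Definition item_a (L : vectLieType F) :=
  exists2 t, (1 <= t <= 4)%N & lie_iso L (n2 F t).

Definition item_b (L : vectLieType F) :=
  exists2 I, ideal_b I & exists idI : is_ideal I, lie_iso L (lie_quot (vs_ideal idI)).

Definition item_c (L : vectLieType F) :=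
  exists2 I, ideal_c I & exists idI : is_ideal I, lie_iso L (lie_quot (vs_ideal idI)).

Definition listed (L : vectLieType F) := [\/ item_a L, item_b L | item_c L].

End List.

(* Main.v *)
Require Import Defs.
From HB Require Import structures.
From mathcomp Require Import all_boot all_order all_algebra.
From mathcomp Require Import ring.
From mathcomp Require Import boolp reals.
From mathcomp Require Import complex.

(** Classification.  A Lie algebra L of type 2 and nilindex t is generated by two
    elements a0, a1 that are independent modulo the derived algebra, so it is a
    quotient of the free nilpotent algebra n2 F t by an ideal J contained in
    lcs 2 and not containing lcs t.  Bracketing with the generators shows that J
    lies in lcs 3 for t = 4 and in lcs t for t <= 3, and for t = 4 determines J
    when it is not contained in lcs 4 (n2_ideal_small, n2_3_ideal, n2_4_ideal).
    Conversely such quotients keep the type and the nilindex.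

    This needs the dimensions of the layers lcs k / lcs (k + 1) of n2 F t, which
    come without an explicit model.  Every linear map on the span of the
    generators extends to a derivation (freeNil_derivation), so that sl2 acts on
    n2 F t, and for k <= 4 the k-th layer is irreducible: one nontrivial relation
    among its natural generators, raised and lowered by sl2, kills the layer
    (gw_indep, gz_indep, gx_indep).  But no layer up to the t-th is zero, since
    n2 F t maps onto the filiform algebra of nilindex t (lcs_n2_neq0).

    Levi extensions.  For n2 F t the semidirect product with sl2 is a nontrivial
    Levi extension (n2_levi).  Conversely, let a Levi factor s act nontrivially
    on L, of type 2 and nilindex t <= 4.  It acts on the 2-dimensional space
    L / lcs 2 by traceless matrices, because s is perfect (semisimple_perfect),
    and the image is a perfect subalgebra of sl2, that is 0 or sl2.  It cannot be
    0, for then s would act by nilpotent operators and, being perfect, trivially.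
    So the raising and lowering matrices come from derivations of L, and the
    irreducibility of the layers now applies to L itself: its layers are as large
    as those of n2 F t, hence L is isomorphic to n2 F t (levi_ext_item_a).  The
    quotients by nonzero ideals are thereby excluded all at once.

    That a Lie algebra over an algebraically closed field with conjugation is
    perfect when it has no nonzero abelian ideal is proved with the Killing form:
    Cartan's argument with the conjugate of the semisimple part of ad x
    (killing_rad_nil), and Engel's theorem (engel). *)

Set Implicit Arguments.
Unset Strict Implicit.
Unset Printing Implicit Defensive.

Import GRing.Theory Num.Theory passmx.
Local Open Scope ring_scope.

(** * Bracket subspaces, lower central series and isomorphisms *)

Lemma span_ind (F : fieldType) (V : vectType F) (X : seq V) (P : V -> Prop) :
  P 0 -> (forall a x y, P x -> P y -> P (a *: x + y)) ->
  (forall x, x \in X -> P x) -> forall z, z \in <<X>>%VS -> P z.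
Proof.
move=> P0 Plin; elim: X => [_ z|x X IH PX z].
  by rewrite span_nil memv0 => /eqP->.
rewrite span_cons => /memv_addP[_ /vlineP[a ->] [y yX ->]].
apply: Plin; first by apply: PX; rewrite mem_head.
by apply: IH yX => u uX; apply: PX; rewrite inE uX orbT.
Qed.

Section LieProd.
Variables (F : fieldType) (L : vectLieType F).
Implicit Types (x y : L) (U V W I : {vspace L}).

Lemma mem_lie_prod U V x y : x \in U -> y \in V -> lie x y \in lie_prod U V.
Proof.
move=> xU yV; rewrite (coord_vbasis xU) (coord_vbasis yV).
rewrite linear_sum memv_suml // => j _; rewrite linearZ memvZ //=.
set u := \sum_i _; rewrite lieC memvN linear_sum memv_suml // => i _.
rewrite linearZ memvZ //= lieC memvN; apply: memv_span.
by apply: allpairs_f; rewrite mem_nth ?size_tuple.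
Qed.

Lemma lie_prod_subP U V W :
  reflect (forall x y, x \in U -> y \in V -> lie x y \in W) (lie_prod U V <= W)%VS.
Proof.
apply: (iffP idP) => [/subvP sub x y xU yV|sub]; first exact/sub/mem_lie_prod.
apply/span_subvP => _ /allpairsP[[u v] /= [uU vV ->]].
by apply: sub; apply: vbasis_mem.
Qed.

Lemma lie_prod_ind U V (P : L -> Prop) :
  P 0 -> (forall a x y, P x -> P y -> P (a *: x + y)) ->
  (forall x y, x \in U -> y \in V -> P (lie x y)) ->
  forall z, z \in lie_prod U V -> P z.
Proof.
move=> P0 Plin Pb; apply: span_ind => // _ /allpairsP[[u v] /= [uU vV ->]].
by apply: Pb; apply: vbasis_mem.
Qed.

Lemma lie_prod_span (s t : seq L) W :
  (forall u v, u \in s -> v \in t -> lie u v \in W) -> (lie_prod <<s>> <<t>> <= W)%VS.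
Proof.
move=> st; apply/lie_prod_subP => x y; move: x; apply: span_ind => [_|a x x' IH IH' yt|u us].
- by rewrite lie0l mem0v.
- by rewrite lieDl lieZl rpredD ?rpredZ ?IH ?IH'.
move: y; apply: span_ind => [|a y y' IH IH'|v vt].
- by rewrite lie0r mem0v.
- by rewrite lieDr lieZr rpredD ?rpredZ.
- exact: st.
Qed.

Lemma lie_prodS U U' V V' :
  (U <= U')%VS -> (V <= V')%VS -> (lie_prod U V <= lie_prod U' V')%VS.
Proof.
move=> /subvP sU /subvP sV; apply/lie_prod_subP => x y xU yV.
by rewrite mem_lie_prod ?sU ?sV.
Qed.

Lemma idealP I : reflect (forall x y, y \in I -> lie x y \in I) (is_ideal I).
Proof.
apply: (iffP (lie_prod_subP _ _ _)) => h x y; first by apply: h; rewrite memvf.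
by move=> _; apply: h.
Qed.

Lemma lcsS k : lcs L k.+2 = lie_prod fullv (lcs L k.+1). Proof. by []. Qed.

Lemma mem_lcsS k x y : y \in lcs L k.+1 -> lie x y \in lcs L k.+2.
Proof. by move=> ky; rewrite lcsS mem_lie_prod ?memvf. Qed.

Lemma mem_lcs2 x y : lie x y \in lcs L 2.
Proof. by apply: mem_lcsS; rewrite memvf. Qed.

Lemma lcs_subS k : (lcs L k.+1 <= lcs L k)%VS.
Proof.
case: k => [|k]; first exact: subvf.
elim: k => [|k IH]; first exact: subvf.
by rewrite lcsS [in X in (_ <= X)%VS]lcsS lie_prodS.
Qed.

Lemma lcs_sub j k : (j <= k)%N -> (lcs L k <= lcs L j)%VS.
Proof.
move=> /subnK <-; elim: (k - j)%N => //= i IH.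
exact: subv_trans (lcs_subS _) IH.
Qed.

Lemma lcs2_lie k x y :
  x \in lcs L 2 -> y \in lcs L k.+1 -> lie x y \in lcs L k.+3.
Proof.
move=> x2 ky; move: x x2; apply: lie_prod_ind => [|a u v uk vk|p q _ _].
- by rewrite lie0l mem0v.
- by rewrite lieDl lieZl rpredD ?rpredZ.
have -> : lie (lie p q) y = lie p (lie q y) - lie q (lie p y).
  by rewrite (lie_leibniz p) addrK.
by rewrite rpredB //; do 2!apply: mem_lcsS.
Qed.

(** Once the lower central series repeats a term, it is constant. *)
Lemma lcs_stable k j : lcs L k.+2 = lcs L k.+1 -> (k.+1 <= j)%N -> lcs L j = lcs L k.+1.
Proof.
move=> st /subnK <-; elim: (j - _)%N => //= i IH.
by rewrite addSn addnS lcsS -addnS IH -lcsS.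
Qed.

End LieProd.

Section Morph.
Variables (F : fieldType) (L M : vectLieType F) (f : {linear L -> M}).
Hypothesis fm : lie_morph f.

Lemma lker_ideal : is_ideal (lker (linfun f)).
Proof.
apply/idealP => x y; rewrite !memv_ker !lfunE /= fm => /eqP->.
by rewrite lie0r.
Qed.

Lemma limg_lie_prod U V : (linfun f @: lie_prod U V = lie_prod (linfun f @: U) (linfun f @: V))%VS.
Proof.
apply/eqP; rewrite eqEsubv; apply/andP; split.
  apply/subvP => _ /memv_imgP[z zUV ->]; move: z zUV.
  apply: lie_prod_ind => [|a x y xU yV|x y xU yV]; first by rewrite linear0 mem0v.
    by rewrite linearP rpredD ?rpredZ.
  by rewrite lfunE /= fm -!(lfunE f) mem_lie_prod ?memv_img.
apply/lie_prod_subP => _ _ /memv_imgP[x xU ->] /memv_imgP[y yV ->].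
by rewrite !lfunE -fm -(lfunE f) memv_img ?mem_lie_prod.
Qed.

Lemma mem_lcs_morph k x : x \in lcs L k -> f x \in lcs M k.
Proof.
case: k => [|k]; first by move=> _; apply: memvf.
elim: k x => [|k IH] x; first by move=> _; apply: memvf.
rewrite lcsS; move: x; apply: lie_prod_ind => [|a x y xk yk|x y _ yk].
- by rewrite linear0 mem0v.
- by rewrite linearP rpredD ?rpredZ.
- by rewrite fm; apply/mem_lcsS/IH.
Qed.

Lemma limg_lcs k : limg (linfun f) = fullv -> (linfun f @: lcs L k = lcs M k)%VS.
Proof.
move=> fs; case: k => // k; elim: k => //= k IH.
by rewrite !lcsS limg_lie_prod IH fs.
Qed.

End Morph.

Section Iso.
Variables (F : fieldType).
Implicit Types L M N : vectLieType F.

Lemma lie_iso_sym (L M : lieType F) : lie_iso L M -> lie_iso M L.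
Proof.
move=> [f [g fK gK] fm].
have glin : linear g by move=> a x y; apply: (can_inj fK); rewrite linearP !gK.
pose gL : {linear M -> L} := HB.pack g (GRing.isLinear.Build F M L *:%R g glin).
exists gL; first by exists f.
by move=> x y /=; apply: (can_inj fK); rewrite fm !gK.
Qed.

Lemma lie_iso_dim_lcs L M k : lie_iso L M -> \dim (lcs L k) = \dim (lcs M k).
Proof.
move=> [f fb fm]; have [g fK gK] := fb.
have fs : limg (linfun f) = fullv.
  apply/vspaceP => y; rewrite memvf -[y]gK -(lfunE f).
  by rewrite memv_img ?memvf.
rewrite -(limg_lcs fm _ fs) limg_dim_eq //; apply/eqP; rewrite -subv0.
apply/subvP => x /memv_capP[_]; rewrite memv_ker lfunE memv0 /=.
by rewrite -(inj_eq (can_inj fK)) linear0.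
Qed.

Lemma lie_iso_nil_type L M : lie_iso L M -> nil_type L = nil_type M.
Proof.
move=> iso; rewrite /nil_type (lie_iso_dim_lcs 2 iso).
by rewrite (lie_iso_dim_lcs 1 iso).
Qed.

Lemma lie_iso_nilindex L M t : lie_iso L M -> nilindex L t = nilindex M t.
Proof.
by move=> iso; rewrite /nilindex -!dimv_eq0 !(lie_iso_dim_lcs _ iso).
Qed.

(** The first isomorphism theorem. *)
Lemma lie_quot_lker L M (f : {linear L -> M}) (fm : lie_morph f)
    (I : {vspace L}) (idI : is_ideal I) :
  limg (linfun f) = fullv -> lker (linfun f) = I ->
  lie_iso M (lie_quot (vs_ideal idI)).
Proof.
move=> fs fI; apply: lie_iso_sym.
pose g (u : lie_quot (vs_ideal idI)) := f (repr u).
have gE x : g (lie_proj _ x) = f x.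
  apply/eqP; rewrite /g -subr_eq0 -linearB -(lfunE f) -memv_ker fI.
  exact: (lie_reprE (vs_ideal idI) x).
have glin : linear g.
  move=> a; elim/lie_proj_ind=> x; elim/lie_proj_ind=> y.
  by rewrite -linearP !gE linearP.
pose gL : {linear lie_quot (vs_ideal idI) -> M} :=
  HB.pack g (GRing.isLinear.Build F _ M *:%R g glin).
have ginj : injective gL.
  apply: raddf_inj; elim/lie_proj_ind => x /=; rewrite gE => /eqP.
  by rewrite -(lfunE f) -memv_ker fI => xI; apply/eqP; rewrite lie_proj_eq0.
have gsurj y : exists u, g u == y.
  have /memv_imgP[x _ ->] : y \in limg (linfun f) by rewrite fs memvf.
  by exists (lie_proj _ x); rewrite gE lfunE.
exists gL; last first.
  elim/lie_proj_ind=> x; elim/lie_proj_ind=> y.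
  by rewrite -lie_proj_morph /= !gE fm.
pose h y := xchoose (gsurj y).
have hK : cancel h gL by move=> y; apply/eqP/(xchooseP (gsurj y)).
by exists h => // u; apply: ginj; rewrite hK.
Qed.

Lemma bij_iso L M (f : {linear L -> M}) :
  lie_morph f -> limg (linfun f) = fullv -> lker (linfun f) = 0%VS -> lie_iso M L.
Proof.
move=> fm fs /eqP f0; apply: lie_iso_sym; exists f => //.
have fi : injective f.
  by move=> x y; rewrite -!(lfunE f); move/lker0P: f0; apply.
exists (linfun f)^-1%VF => x; first by rewrite -[f x]lfunE lker0_lfunK.
by rewrite -[f _]lfunE limg_lfunVK // fs memvf.
Qed.

End Iso.

(** * Engel's theorem *)

Section Engel.
Variables (F : fieldType) (L : vectLieType F).
Implicit Types (x y : L) (U V W E K : {vspace L}).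

(** ad x is nilpotent: some power of it vanishes on all of L. *)
Definition ad_nil x := exists N, forall y, iter N (lie x) y = 0.

Lemma is_subalgebra0 : is_subalgebra (0%VS : {vspace L}).
Proof.
apply/lie_prod_subP => x y; rewrite memv0 => /eqP-> _.
by rewrite lie0l mem0v.
Qed.

Lemma subalgebra_add_line K x :
  is_subalgebra K -> (forall k, k \in K -> lie k x \in K) ->
  is_subalgebra (K + <[x]>)%VS.
Proof.
move=> subK Kx; apply/lie_prod_subP => u v /memv_addP[k kK [_ /vlineP[a ->] ->]].
move=> /memv_addP[l lK [_ /vlineP[b ->] ->]].
rewrite !(lieDl, lieDr, lieZl, lieZr) liexx !scaler0 ?addr0.
rewrite (lieC x l) scalerN.
apply: (subvP (addvSl K <[x]>)).
by rewrite !(rpredB, rpredD) ?rpredZ ?mem0v ?Kx // (lie_prod_subP _ _ _ subK).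
Qed.

(** Engel's theorem, in the form that its own induction needs: the statement is
    relative to a pair W, E of U-stable subspaces with E not inside W, and gives
    a vector of E outside W that U sends into W.  This covers both the action of
    U on L (W = 0) and that of a subalgebra K of U on U / K, without forming
    the quotient. *)
Theorem engel U :
  is_subalgebra U -> (forall x, x \in U -> ad_nil x) ->
  forall E W, (lie_prod U E <= E)%VS -> (lie_prod U W <= W)%VS ->
    ~~ (E <= W)%VS ->
  exists v, [/\ v \in E, v \notin W & forall x, x \in U -> lie x v \in W].
Proof.
move: {2}(\dim U) (erefl (\dim U)) => n; elim/ltn_ind: n U => n IH U dU subU nilU.
move=> E W UE UW EW.
(* With E = U and W = K the induction hypothesis yields x normalizing a
   proper subalgebra K, so K can be enlarged one dimension at a time. *)
have grow k : (k < n)%N -> exists K, [/\ (K <= U)%VS, is_subalgebra K, \dim K = k &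
    exists x, [/\ x \in U, x \notin K & forall y, y \in K -> lie y x \in K]].
  elim: k => [|k IHk] ltkn.
    have [u uU u0] : exists2 u, u \in U & u \notin 0%VS.
      by apply/subvPn; rewrite subv0 -dimv_eq0 dU -lt0n.
    exists 0%VS; split; rewrite ?sub0v ?dimv0 //; first exact: is_subalgebra0.
    by exists u; split=> // y; rewrite memv0 => /eqP->; rewrite lie0l mem0v.
  have [K [KU subK dK [x [xU xK Kx]]]] := IHk (ltnW ltkn).
  pose K' := (K + <[x]>)%VS; have K'U : (K' <= U)%VS by rewrite subv_add KU.
  have subK' : is_subalgebra K' by apply: subalgebra_add_line.
  have dK' : \dim K' = k.+1.
    have x0 : x != 0 by apply: contraNneq xK => ->; rewrite mem0v.
    rewrite /K' dimv_disjoint_sum ?dK ?dim_vline ?x0 ?addn1 //.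
    apply/eqP; rewrite -subv0; apply/subvP => y /memv_capP[yK /vlineP[a Ey]].
    move: yK; rewrite {y}Ey memv0.
    have [->|a0] := eqVneq a 0; first by rewrite scale0r eqxx.
    by move/(memvZ a^-1); rewrite scalerA mulVf // scale1r (negPf xK).
  exists K'; split=> //.
  have UK' : ~~ (U <= K')%VS.
    by apply: contraL ltkn => /dimvS; rewrite dK' dU -leqNgt.
  have nilK' y : y \in K' -> ad_nil y by move/(subvP K'U)/nilU.
  have [|v [vU vK' K'v]] := IH k.+1 ltkn K' dK' subK' nilK' U K' _ subK' UK'.
    by apply: subv_trans subU; apply: lie_prodS.
  by exists v.
case: n => [|n] in IH dU grow *.
  have [v vE vW] := subvPn EW; exists v; split=> // x.
  have /eqP-> : U == 0%VS by rewrite -dimv_eq0 dU.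
  by rewrite memv0 => /eqP->; rewrite lie0l mem0v.
have [K [KU subK dK [x [xU xK Kx]]]] := grow n (ltnSn n).
have defU : (K + <[x]>)%VS = U.
  apply/eqP; rewrite eqEdim subv_add KU [(<[x]> <= U)%VS]xU dU -dK.
  rewrite (@leq_ltn_trans (\dim K)) //.
  rewrite ltn_neqAle dimvS ?addvSl // andbT.
  apply: contra xK; rewrite (dimv_leqif_sup (addvSl _ _)) subv_add => /andP[_].
  exact.
have nilK y : y \in K -> ad_nil y by move/(subvP KU)/nilU.
have KE := subv_trans (lie_prodS KU (subvv E)) UE.
have KW := subv_trans (lie_prodS KU (subvv W)) UW.
have [v [vE vW Kv]] := IH n (ltnSn n) K dK subK nilK E W KE KW EW.
(* Since x normalizes K, the whole x-orbit of v stays in the part of E that K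
   sends into W; the last term of that orbit outside W is the wanted vector. *)
pose v_ i := iter i (lie x) v.
have v_E i : v_ i \in E.
  by elim: i => //= i IHi; rewrite (lie_prod_subP _ _ _ UE).
have v_K i y : y \in K -> lie y (v_ i) \in W.
  elim: i y => [|i IHi] y yK; first exact: Kv.
  rewrite /v_ iterS lie_leibniz rpredD //; first by apply: IHi; apply: Kx.
  by rewrite (lie_prod_subP _ _ _ UW) // IHi.
have exN : exists N, v_ N \in W.
  by have [N vN] := nilU x xU; exists N; rewrite /v_ vN mem0v.
case: (ex_minnP exN) => [[|N]]; first by rewrite (negPf vW).
move=> vNW minN; exists (v_ N); split=> //.
  by apply: contraT; rewrite negbK => /minN; rewrite ltnn.
move=> y; rewrite -defU => /memv_addP[k kK [_ /vlineP[a ->] ->]].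
by rewrite lieDl lieZl; apply: rpredD; [apply: v_K | apply/rpredZ/vNW].
Qed.

End Engel.

(** * Eigenvalues and polynomials of a complex matrix *)

Section FunctionalCalculus.

(** Chinese remainders: a polynomial with prescribed values c r modulo the
    powers ('X - r)^m. *)
Lemma poly_crt (F : fieldType) (c : F -> F) m (rs : seq F) :
  exists q, forall r, r \in rs -> ('X - r%:P) ^+ m %| q - (c r)%:P.
Proof.
elim: rs => [|a rs [q qP]]; first by exists 0.
have [ars|ars] := boolP (a \in rs).
  by exists q => r; rewrite inE => /orP[/eqP->|]; apply: qP.
pose P := \prod_(r <- rs) ('X - r%:P) ^+ m.
have cop : coprimep P (('X - a%:P) ^+ m).
  by rewrite /P prodrXl coprimep_expl ?coprimep_expr ?coprimep_XsubC ?root_prod_XsubC.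
have /Bezout_eq1_coprimepP[[u v] /= uv] := cop.
exists (q + u * P * ((c a)%:P - q)) => r; rewrite inE => /orP[/eqP->|rrs].
  have -> : q + u * P * ((c a)%:P - q) - (c a)%:P
      = v * (('X - a%:P) ^+ m) * (q - (c a)%:P).
    have -> : u * P = 1 - v * ('X - a%:P) ^+ m by rewrite -uv addrK.
    ring.
  by rewrite mulrAC dvdp_mull.
rewrite addrAC dvdp_add ?qP // mulrAC dvdp_mull //.
by rewrite /P (big_rem r) //= dvdp_mulr.
Qed.

Lemma horner_mx_trig (F : fieldType) n (T : 'M[F]_n.+1) (q : {poly F}) :
  is_trig_mx T ->
  is_trig_mx (horner_mx T q) /\ forall i, horner_mx T q i i = q.[T i i].
Proof.
move=> /is_trig_mxP trT.
have mul (A B : 'M[F]_n.+1) : is_trig_mx A -> is_trig_mx B ->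
    is_trig_mx (A * B) /\ forall i, (A * B) i i = A i i * B i i.
  move=> /is_trig_mxP trA /is_trig_mxP trB; split.
    apply/is_trig_mxP => i j ij; rewrite mxE big1 // => k _.
    have [ik|ki] := ltnP i k; first by rewrite trA ?mul0r.
    by rewrite trB ?mulr0 // (leq_ltn_trans ki).
  move=> i; rewrite mxE (bigD1 i) //= big1 ?addr0 // => k ki.
  have [ik|ik] := ltnP i k; first by rewrite trA ?mul0r.
  by rewrite trB ?mulr0 // ltn_neqAle ki.
elim/poly_ind: q => [|q c [tr diag]].
  by rewrite rmorph0 mx0_is_trig; split=> // i; rewrite mxE horner0.
rewrite rmorphD rmorphM /= horner_mx_X horner_mx_C.
have [|trM diM] := mul (horner_mx T q) T tr; first exact/is_trig_mxP.
split=> [|i]; last by rewrite mxE diM diag !hornerE mxE eqxx.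
move/is_trig_mxP in trM; apply/is_trig_mxP => i j ij; rewrite mxE trM //.
by rewrite mxE -val_eqE /= (ltn_eqF ij) mulr0n addr0.
Qed.

Variable C : numClosedFieldType.

(** The part of the Jordan decomposition that is needed.  For some list rs
    (diagonal of a triangular form of A, hence the eigenvalues), row vectors are
    sums of generalized eigenvectors with eigenvalue in rs; and if a polynomial
    q takes each eigenvalue to its conjugate, then the trace of A q(A) is the
    sum of |a|^2 over rs, so that A is nilpotent when this trace vanishes. *)
Lemma generalized_eigen_calculus n (A : 'M[C]_n.+1) :
  exists (rs : seq C) m,
  [/\ forall P : 'rV[C]_n.+1 -> Prop,
        (forall u v, P u -> P v -> P (u + v)) ->
        (forall a v, a \in rs -> v *m (A - a%:M) ^+ m = 0 -> P v) -> forall v, P v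
    & forall q, (forall a, a \in rs -> q.[a] = a^*) ->
        \tr (A *m horner_mx A q) = 0 -> exists N, A ^+ N = 0].
Proof.
have [P Pu] := @Schur C n.+1 A isT.
set T := conjmx P A => /= trT; have {}Pu := unitarymx_unit Pu.
pose rs := [seq T i i | i : 'I_n.+1]; exists rs, n.+1.
have TA q : horner_mx T q = P *m horner_mx A q *m invmx P.
  by rewrite /T conjumx // horner_mx_uconj.
have AT q : horner_mx A q = invmx P *m horner_mx T q *m P.
  by rewrite TA !mulmxA mulVmx // mul1mx -mulmxA mulVmx // mulmx1.
split.
- move=> Q QD Qg.
  have ind us v : uniq us -> {subset us <= rs} ->
      v *m horner_mx A (\prod_(r <- us) ('X - r%:P) ^+ n.+1) = 0 -> Q v.
    elim: us v => [|a us IH] v /=.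
      rewrite big_nil rmorph1 mulmx1 => _ _ ->.
      apply: (Qg (T ord0 ord0)); last by rewrite mul0mx.
      by apply: map_f; rewrite mem_enum.
    move=> /andP[aus uus] usrs; rewrite big_cons => v0.
    have cop : coprimep (('X - a%:P) ^+ n.+1) (\prod_(r <- us) ('X - r%:P) ^+ n.+1).
      rewrite coprimep_sym prodrXl coprimep_expl ?coprimep_expr //.
      by rewrite coprimep_XsubC root_prod_XsubC.
    have : (v <= kermxpoly A (('X - a%:P) ^+ n.+1 *
                 \prod_(r <- us) ('X - r%:P) ^+ n.+1))%MS by apply/sub_kermxP.
    rewrite (kermxpolyM _ cop) => /sub_addsmxP[[w1 w2] /= ->]; apply: QD.
      apply: (Qg a); first by apply: usrs; rewrite mem_head.
      have -> : (A - a%:M) ^+ n.+1 = horner_mx A (('X - a%:P) ^+ n.+1).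
        by rewrite rmorphXn rmorphB /= horner_mx_X horner_mx_C.
      by rewrite -mulmxA mulmx_ker mulmx0.
    apply: IH => //; first by move=> r rus; apply: usrs; rewrite inE rus orbT.
    by rewrite -mulmxA mulmx_ker mulmx0.
  move=> v; apply: (ind (undup rs)); rewrite ?undup_uniq //.
    by move=> r; rewrite mem_undup.
  suff -> : horner_mx A (\prod_(r <- undup rs) ('X - r%:P) ^+ n.+1) = 0.
    by rewrite mulmx0.
  have dv : char_poly T %| \prod_(r <- undup rs) ('X - r%:P) ^+ n.+1.
    rewrite char_poly_trig // prodrXl.
    have -> : \prod_(i < n.+1) ('X - (T i i)%:P) = \prod_(r <- rs) ('X - r%:P).
      by rewrite /rs big_map big_enum.
    have -> : n.+1 = size rs by rewrite size_map size_enum_ord.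
    have dvd_us us vs : {subset us <= vs} ->
        \prod_(r <- us) ('X - r%:P) %| (\prod_(r <- vs) ('X - r%:P)) ^+ size us.
      elim: us => [|a us IH] sub; first by rewrite big_nil dvd1p.
      rewrite big_cons exprS /=; apply: dvdp_mul.
        by rewrite (big_rem a) /= ?dvdp_mulr // sub ?mem_head.
      by apply: IH => r rus; apply: sub; rewrite inE rus orbT.
    by apply: dvd_us => r; rewrite mem_undup.
  by have [w ->] := dvdpP _ _ dv; rewrite AT rmorphM /= Cayley_Hamilton mulr0 mulmx0 mul0mx.
move=> q qP; have {1}-> : A = horner_mx A 'X by rewrite horner_mx_X.
have -> : horner_mx A 'X *m horner_mx A q = horner_mx A ('X * q) by rewrite rmorphM.
rewrite AT mxtrace_mulC mulmxA mulmxV // mul1mx => tr0.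
have T0 i : T i i = 0.
  have sum0 : \sum_i `|T i i| ^+ 2 = 0.
    rewrite -[RHS]tr0; apply: eq_bigr => j _.
    have [_ ->] := horner_mx_trig ('X * q) trT.
    rewrite hornerM hornerX qP ?normCK //.
    by apply: map_f; rewrite mem_enum.
  have /eqP := psumr_eq0P (i := i) (fun j _ => exprn_ge0 2 (normr_ge0 (T j j))) sum0 isT.
  by rewrite expf_eq0 normr_eq0 => /eqP.
exists n.+1; have -> : A ^+ n.+1 = horner_mx A ('X ^+ n.+1).
  by rewrite rmorphXn /= horner_mx_X.
rewrite AT; have -> : 'X ^+ n.+1 = char_poly T.
  rewrite char_poly_trig //; under eq_bigr do rewrite T0 subr0.
  by rewrite prodr_const card_ord.
by rewrite Cayley_Hamilton mulmx0 mul0mx.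
Qed.

End FunctionalCalculus.

(** * The Killing form *)

Section Killing.
Variables (C : numClosedFieldType) (L : vectLieType C) (n : nat).
Variables (r : {linear L -> 'rV[C]_n.+1}) (s : {linear 'rV[C]_n.+1 -> L}).
Hypotheses (rK : cancel r s) (sK : cancel s r).
Implicit Types (x y z u v : L).

(** The matrix of ad x in the coordinates r, acting on row vectors; products of
    matrices are therefore in the order opposite to composition. *)
Definition ad_mx x : 'M[C]_n.+1 := lin1_mx (r \o lie x \o s).

Lemma mul_ad_mx (u : 'rV_n.+1) x : u *m ad_mx x = r (lie x (s u)).
Proof. by rewrite mul_rV_lin1. Qed.

Lemma ad_mxE x v : r v *m ad_mx x = r (lie x v).
Proof. by rewrite mul_ad_mx rK. Qed.

Lemma mx_eqP (A B : 'M[C]_n.+1) : (forall v, r v *m A = r v *m B) -> A = B.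
Proof. by move=> AB; apply/row_matrixP => i; rewrite !rowE -[delta_mx _ _]sK AB. Qed.

Lemma ad_mx_linear : linear ad_mx.
Proof.
move=> a x y; apply: mx_eqP => v.
by rewrite mulmxDr -scalemxAr !ad_mxE lieDl lieZl linearP.
Qed.
HB.instance Definition _ :=
  GRing.isLinear.Build C L 'M[C]_n.+1 *:%R ad_mx ad_mx_linear.

Lemma ad_mx_lie x y : ad_mx (lie x y) = ad_mx y *m ad_mx x - ad_mx x *m ad_mx y.
Proof.
apply: mx_eqP => v; rewrite mulmxBr !mulmxA !ad_mxE -linearB; congr (r _).
by rewrite (lie_leibniz x y v) addrK.
Qed.

(** The Killing form. *)
Definition killing x y := \tr (ad_mx x *m ad_mx y).

Lemma killingC x y : killing x y = killing y x.
Proof. exact: mxtrace_mulC. Qed.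

Lemma killing_invariant x y z : killing (lie x y) z = killing x (lie y z).
Proof.
rewrite /killing !ad_mx_lie mulmxBl mulmxBr !linearB /= !mulmxA; congr (_ - _).
by rewrite [RHS]mxtrace_mulC mulmxA.
Qed.

(** The values of the Killing form at x on the coordinate basis. *)
Definition killing_row x : 'rV[C]_n.+1 := \row_j killing x (s (delta_mx 0 j)).

Lemma killing_row_linear : linear killing_row.
Proof.
move=> a x y; apply/rowP => j.
by rewrite !mxE /killing linearP mulmxDl -scalemxAl linearP.
Qed.
HB.instance Definition _ :=
  GRing.isLinear.Build C L 'rV[C]_n.+1 *:%R killing_row killing_row_linear.

(** The radical of the Killing form. *)
Definition killing_rad : {vspace L} := lker (linfun killing_row).

Lemma killing_radP x : reflect (forall y, killing x y = 0) (x \in killing_rad).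
Proof.
rewrite memv_ker lfunE; apply: (iffP eqP) => [x0 y|x0]; last first.
  by apply/rowP => j; rewrite !mxE x0.
rewrite -[y]rK (row_sum_delta (r y)) /killing !linear_sum /= big1 // => j _.
rewrite !linearZ /=.
by have /rowP/(_ j) := x0; rewrite !mxE /killing => ->; rewrite mulr0.
Qed.

Lemma killing_rad_ideal : is_ideal killing_rad.
Proof.
apply/idealP => x y /killing_radP y0; apply/killing_radP => z.
by rewrite killing_invariant killingC killing_invariant y0.
Qed.

(** The bracket of generalized eigenvectors of ad x for a and b is zero or a
    generalized eigenvector for a + b. *)
Lemma geigen_lie x a b i j u v :
  r u *m (ad_mx x - a%:M) ^+ i = 0 -> r v *m (ad_mx x - b%:M) ^+ j = 0 ->
  r (lie u v) *m (ad_mx x - (a + b)%:M) ^+ (i + j) = 0.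
Proof.
have step c w : r w *m (ad_mx x - c%:M) = r (lie x w - c *: w).
  by rewrite [RHS]linearB linearZ /= mulmxBr ad_mxE mul_mx_scalar.
have inj0 w : r w = 0 -> w = 0 by move=> w0; rewrite -[w]rK w0 linear0.
move: {2}(i + j)%N (leqnn (i + j)) => k.
elim: k i j u v => [|k IH] i j u v ijk.
  move: ijk; rewrite leqn0 addn_eq0 => /andP[/eqP-> _].
  by rewrite expr0 mulmx1 => /inj0-> _; rewrite lie0l linear0 mul0mx.
case: i ijk => [|i] ijk.
  by rewrite expr0 mulmx1 => /inj0-> _; rewrite lie0l linear0 mul0mx.
case: j ijk => [|j] ijk u0.
  by rewrite expr0 mulmx1 => /inj0->; rewrite lie0r linear0 mul0mx.
move=> v0.
have u1 : r (lie x u - a *: u) *m (ad_mx x - a%:M) ^+ i = 0.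
  by rewrite -step -mulmxA -[RHS]u0 exprS.
have v1 : r (lie x v - b *: v) *m (ad_mx x - b%:M) ^+ j = 0.
  by rewrite -step -mulmxA -[RHS]v0 exprS.
rewrite addSn exprS mulmxA step.
have -> : lie x (lie u v) - (a + b) *: lie u v
    = lie (lie x u - a *: u) v + lie u (lie x v - b *: v).
  rewrite lieBl lieBr lieZl lieZr lie_leibniz scalerDl opprD.
  by rewrite addrACA.
rewrite linearD mulmxDl [X in X + _](_ : _ = 0) ?add0r.
  by rewrite addnS -addSn; apply: IH => //; rewrite addSn -ltnS -addnS.
by rewrite IH // addnS -ltnS -addSn.
Qed.

(** The core of Cartan's criterion.  Let y be the linear map acting as the
    conjugate of a on the generalized eigenspace of ad x for a.  By geigen_lie
    and additivity of conjugation y is a derivation of L; writing x as a sum of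
    brackets [z, t] of elements of the Killing radical, the trace of (ad x) y
    becomes a sum of values of the Killing form at z and y t, up to sign, hence
    vanishes, and ad x is nilpotent. *)
Lemma killing_rad_nil x :
  x \in lie_prod killing_rad killing_rad -> exists N, ad_mx x ^+ N = 0.
Proof.
move=> xK; have [rs [m [ind nil]]] := generalized_eigen_calculus (ad_mx x).
(* q must conjugate the sums of two eigenvalues as well, whether or not they
   are eigenvalues themselves. *)
pose ns := rs ++ [seq a + b | a <- rs, b <- rs].
have [q qP] := poly_crt (fun a : C => a^*) (m + m).+1 ns.
have qv a (v : 'rV_n.+1) k : a \in ns -> (k <= (m + m).+1)%N -> v *m (ad_mx x - a%:M) ^+ k = 0 ->
    v *m horner_mx (ad_mx x) q = a^* *: v.
  move=> /qP /dvdpP[w qw] km v0; apply/eqP; rewrite -subr_eq0.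
  rewrite -mul_mx_scalar -mulmxBr.
  have -> : horner_mx (ad_mx x) q - (a^*)%:M = horner_mx (ad_mx x) (q - (a^*)%:P).
    by rewrite rmorphB /= horner_mx_C.
  rewrite qw mulrC -(subnKC km) exprD -mulrA rmorphM /= mulmxA.
  suff -> : horner_mx (ad_mx x) (('X - a%:P) ^+ k) = (ad_mx x - a%:M) ^+ k.
    by rewrite v0 mul0mx.
  by rewrite rmorphXn rmorphB /= horner_mx_X horner_mx_C.
pose y v := s (r v *m horner_mx (ad_mx x) q).
have yE v : r (y v) = r v *m horner_mx (ad_mx x) q by rewrite /y sK.
have yD u v : y (u + v) = y u + y v by rewrite /y linearD mulmxDl linearD.
have yr a v k : a \in ns -> (k <= (m + m).+1)%N -> r v *m (ad_mx x - a%:M) ^+ k = 0 ->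
    y v = a^* *: v.
  by move=> ans km v0; rewrite /y (qv a _ k) // linearZ rK.
have in_ns a : a \in rs -> a \in ns by move=> ars; rewrite mem_cat ars.
have mm : (m <= (m + m).+1)%N by rewrite leqW ?leq_addr.
have der u v : y (lie u v) = lie (y u) v + lie u (y v).
  rewrite -[u]rK; move: (r u); apply: (ind _) => {u} [u1 u2 IH1 IH2|a u ars u0].
    by rewrite !linearD /= !yD !lieDl yD IH1 IH2 addrACA.
  rewrite -[v]rK; move: (r v); apply: (ind _) => {v} [v1 v2 IH1 IH2|b v brs v0].
    by rewrite !linearD /= !yD !linearD /= IH1 IH2 addrACA.
  rewrite (yr a (s u) m) ?sK ?in_ns // (yr b (s v) m) ?sK ?in_ns //.
  rewrite (yr (a + b) _ (m + m)%N) ?leqnSn //.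
  - by rewrite rmorphD scalerDl lieZl linearZ.
  - by rewrite mem_cat allpairs_f ?orbT.
  - by apply: geigen_lie; rewrite sK.
apply: (nil q) => [a ars|].
  have /dvdpP[w qw] := qP a (in_ns a ars).
  apply/eqP; rewrite -subr_eq0 -[a^* in X in X == _](hornerC _ a) -hornerN -hornerD qw.
  by rewrite hornerM horner_exp hornerXsubC subrr expr0n mulr0.
move: {-3}x xK; apply: lie_prod_ind => [|c z t z0 t0|z t zK tK].
- by rewrite linear0 mul0mx linear0.
- by rewrite linearP mulmxDl -scalemxAl linearP /= z0 t0 mulr0 addr0.
set Y := horner_mx (ad_mx x) q in yE *.
have tY : Y *m ad_mx t - ad_mx t *m Y = - ad_mx (y t).
  apply: mx_eqP => v; rewrite mulmxBr mulmxN !mulmxA ad_mxE -yE !ad_mxE -yE.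
  by rewrite der linearD opprD addrCA subrr addr0.
rewrite ad_mx_lie mulmxBl linearB /= -mulmxA mxtrace_mulC -2!mulmxA -linearB -mulmxBr tY.
rewrite mulmxN linearN /=.
by have /killing_radP/(_ (y t)) := zK; rewrite /killing => ->; rewrite oppr0.
Qed.

End Killing.

Section Centralizer.
Variables (F : fieldType) (L : vectLieType F).

(** The centralizer of U in L. *)
Definition centralizer (U : {vspace L}) : {vspace L} :=
  (\bigcap_(i < \dim U) lker (linfun (lie (vbasis U)`_i)))%VS.

Lemma centralizerP (U : {vspace L}) v :
  reflect (forall x, x \in U -> lie x v = 0) (v \in centralizer U).
Proof.
rewrite memvE; apply: (iffP subv_bigcapP) => [vU x xU|vU i _]; last first.
  by rewrite -memvE memv_ker lfunE /= vU ?vbasis_mem ?mem_nth ?size_tuple.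
rewrite (coord_vbasis xU) lieC linear_sum big1 ?oppr0 //= => i _.
have := vU i isT; rewrite -memvE memv_ker lfunE /= => /eqP v0.
by rewrite lieZr lieC v0 oppr0 scaler0.
Qed.

Lemma centralizer_ideal U : is_ideal U -> is_ideal (U :&: centralizer U)%VS.
Proof.
move=> /idealP Uid; apply/idealP => x y /memv_capP[yU /centralizerP cy].
apply/memv_capP; split; first exact: Uid.
by apply/centralizerP => z zU; rewrite lie_leibniz (cy z zU) lie0r addr0 cy // lieC memvN Uid.
Qed.
End Centralizer.

Section Perfect.
Variables (C : numClosedFieldType) (L : vectLieType C).

(** A Lie algebra without nonzero abelian ideals is perfect.  With K the Killing
    radical, [K, K] is ad-nilpotent, so by Engel it would have a nonzero center,
    an abelian ideal; thus K is abelian, hence 0, and the Killing form is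
    nondegenerate.  An element orthogonal to [L, L] is then central. *)
Theorem no_abelian_ideal_perfect :
  (forall J : {vspace L}, is_ideal J -> lie_prod J J = 0%VS -> J = 0%VS) ->
  lie_prod (fullv : {vspace L}) fullv = fullv.
Proof.
move=> noab.
pose e := vbasis {:L}; have eb : basis_of {:L} e by apply: vbasisP.
have [n [r [s [rK sK]]]] : exists n (r : {linear L -> 'rV[C]_n})
    (s : {linear 'rV[C]_n -> L}), cancel r s /\ cancel s r.
  exists (\dim {:L}), (rVof e : {linear _ -> _}), (vecof e : {linear _ -> _}).
  by split; [apply: rVofK | apply: vecofK].
case: n r s rK sK => [|n] r s rK sK.
  suff full0 : (fullv : {vspace L}) = 0%VS.
    by apply/eqP; rewrite eqEsubv subvf full0 sub0v.
  by apply/eqP; rewrite -subv0; apply/subvP => x _; rewrite memv0 -[x]rK thinmx0 linear0.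
have sub0 (U : {vspace L}) : (U <= 0)%VS -> U = 0%VS by rewrite subv0 => /eqP.
pose K := killing_rad r s; have Kid : is_ideal K by apply: killing_rad_ideal.
pose D := lie_prod K K.
have Did : is_ideal D.
  apply/idealP => x; apply: lie_prod_ind => [|a y z yD zD|y z yK zK].
  - by rewrite lie0r mem0v.
  - by rewrite linearP rpredD ?rpredZ.
  - by rewrite lie_leibniz rpredD ?mem_lie_prod ?(idealP _ Kid).
have D0 : D = 0%VS.
  have Dsub : is_subalgebra D.
    by apply/lie_prod_subP => x y _ yD; apply: (idealP _ Did).
  have nilD x : x \in D -> ad_nil x.
    move=> /(killing_rad_nil rK sK)[N xN]; exists N => y.
    have rit : r (iter N (lie x) y) = r y *m (ad_mx r s x) ^+ N.
      elim: (N) => [|k IH]; first by rewrite mulmx1.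
      by rewrite iterS exprSr mulmxA -IH ad_mxE.
    by rewrite -[LHS]rK rit xN mulmx0 linear0.
  apply/eqP; rewrite -subv0; apply: contraT => D1.
  have [] := engel Dsub nilD Dsub _ D1.
    by apply/lie_prod_subP => x y _; rewrite memv0 => /eqP->; rewrite lie0r mem0v.
  move=> v [vD v0 Dv].
  suff /sub0 Z0 : (D :&: centralizer D <= 0)%VS.
    case/negP: v0; rewrite -Z0; apply/memv_capP; split=> //.
    by apply/centralizerP => x /Dv; rewrite memv0 => /eqP.
  rewrite subv0; apply/eqP/noab; first exact: centralizer_ideal.
  apply/sub0/lie_prod_subP => x y /memv_capP[xD _] /memv_capP[_ /centralizerP cy].
  by rewrite cy ?mem0v.
have K0 : K = 0%VS by apply: noab.
apply/eqP/contraT => Dn.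
pose P := lie_prod (fullv : {vspace L}) fullv.
have dP : (\dim P < \dim {:L})%N.
  by rewrite ltn_neqAle dimvS ?subvf // andbT; apply: contra Dn; rewrite eqEdim subvf /= => /eqP->.
pose g (x : L) : 'rV[C]_(\dim P) := \row_i killing r s x (vbasis P)`_i.
have glin : linear g.
  by move=> a x y; apply/rowP => i; rewrite !mxE /killing linearP mulmxDl -scalemxAl linearP.
pose gL : {linear L -> 'rV[C]_(\dim P)} :=
  HB.pack g (GRing.isLinear.Build C L _ *:%R g glin).
have ker0 : lker (linfun gL) != 0%VS.
  rewrite -dimv_eq0; apply: contraL dP => /eqP k0.
  rewrite -leqNgt -(limg_ker_dim (linfun gL)) capfv k0 add0n.
  by rewrite (leq_trans (dimvS (subvf _))) // dimvf dim_matrix mul1r.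
pose x := vpick (lker (linfun gL)).
have x0 : x != 0 by rewrite vpick0.
have xP y : y \in P -> killing r s x y = 0.
  move=> yP; rewrite (coord_vbasis yP) /killing linear_sum mulmx_sumr linear_sum big1 // => i _.
  rewrite linearZ -scalemxAr linearZ /=.
  have := memv_pick (lker (linfun gL)); rewrite -/x memv_ker lfunE => /eqP /rowP /(_ i).
  by rewrite !mxE /killing => ->; rewrite mulr0.
have xc y : lie x y = 0.
  apply/eqP; rewrite -memv0 -K0; apply/killing_radP => // z.
  by rewrite killing_invariant // xP // mem_lie_prod ?memvf.
suff X0 : <[x]>%VS = 0%VS.
  by move: (memv_line x); rewrite X0 memv0 (negPf x0).
apply: noab.
  by apply/idealP => y _ /vlineP[a ->]; rewrite lieZr lieC xc oppr0 scaler0 mem0v.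
apply/sub0/lie_prod_subP => _ z /vlineP[a ->] _.
by rewrite lieZl xc scaler0 mem0v.
Qed.

End Perfect.

(** * Subalgebras, abelian and linear Lie algebras, semidirect products *)

(** Vectors are equal when all linear forms agree on them.  The forms are given
    as additive maps that are homogeneous, the shape that ring can process. *)
Lemma vect_ext (F : fieldType) (V : vectType F) (x y : V) :
  (forall f : {additive V -> F}, (forall a v, f (a *: v) = a * f v) -> f x = f y) ->
  x = y.
Proof.
move=> fxy; rewrite (coord_vbasis (memvf x)) (coord_vbasis (memvf y)).
apply: eq_bigr => i _; congr (_ *: _).
apply: (fxy (coord (vbasis fullv) i : {additive V -> F})) => a v.
exact: linearZ.
Qed.

(** Linear identities reduce to polynomial ones in the values of a linear form. *)
Ltac vring := let f := fresh "f" in let fZ := fresh "fZ" in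
  apply: vect_ext => f fZ; rewrite ?(raddfB f, raddfD f, raddfN f, raddf0 f, fZ); ring.

Section SubLie.
Variables (F : fieldType) (L : vectLieType F) (S : {vspace L}).
(** A subalgebra S as a Lie algebra in its own right. *)
Definition subLie_of of is_subalgebra S : Type := subvs_of S.
Hypothesis subS : is_subalgebra S.
Notation subLie := (subLie_of subS).

HB.instance Definition _ := Vector.copy subLie (subvs_of S).

Definition sub_lie (x y : subLie) : subLie := vsproj S (lie (vsval x) (vsval y)).

Lemma vsval_sub_lie x y : vsval (sub_lie x y) = lie (vsval x) (vsval y).
Proof. by rewrite vsprojK // (lie_prod_subP _ _ _ subS) ?subvsP. Qed.

Fact sub_lie_linearl z : linear (sub_lie^~ z).
Proof.
move=> a x y; apply: subvs_inj.
by rewrite vsval_sub_lie !linearP /= !vsval_sub_lie lieDl lieZl.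
Qed.
Fact sub_lie_linearr z : linear (sub_lie z).
Proof.
move=> a x y; apply: subvs_inj.
by rewrite vsval_sub_lie !linearP /= !vsval_sub_lie.
Qed.
Fact sub_liexx x : sub_lie x x = 0.
Proof. by apply: subvs_inj; rewrite vsval_sub_lie liexx linear0. Qed.
Fact sub_lie_jacobi x y z :
  sub_lie x (sub_lie y z) + sub_lie y (sub_lie z x) + sub_lie z (sub_lie x y) = 0.
Proof. by apply: subvs_inj; rewrite !linearD linear0 /= !vsval_sub_lie lie_jacobi. Qed.
HB.instance Definition _ := Lmodule_isLie.Build F subLie
  sub_lie_linearl sub_lie_linearr sub_liexx sub_lie_jacobi.

Definition sub_val : subLie -> L := vsval.
HB.instance Definition _ := GRing.Linear.copy sub_val (@vsval F L S).
Lemma sub_val_morph : lie_morph sub_val.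
Proof. exact: vsval_sub_lie. Qed.
Lemma sub_val_inj : injective sub_val. Proof. exact: subvs_inj. Qed.
Lemma limg_sub_val : limg (linfun sub_val) = S.
Proof.
apply/vspaceP => x; apply/idP/idP => [/memv_imgP[u _ ->]|xS].
  by rewrite lfunE /=; apply: subvsP.
by rewrite -[x](vsprojK xS) -[vsval _](lfunE sub_val) memv_img ?memvf.
Qed.
End SubLie.
Notation subLie := subLie_of.
Arguments sub_val {F L S} subS.
Arguments sub_val_morph {F L S} subS.
Arguments sub_val_inj {F L S} subS [x1 x2].
Arguments limg_sub_val {F L S} subS.

(** A semisimple subalgebra is perfect. *)
Lemma semisimple_perfect (C : numClosedFieldType) (L : vectLieType C) (S : {vspace L}) :
  is_subalgebra S -> semisimple S -> lie_prod S S = S.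
Proof.
move=> subS ssS; pose f := sub_val subS; have fm := sub_val_morph subS.
rewrite -{1 2}(limg_sub_val subS) -(limg_lie_prod fm) no_abelian_ideal_perfect.
  exact: limg_sub_val.
move=> J /idealP idJ J0; apply/eqP; rewrite -subv0; apply/subvP => x xJ.
have: sub_val subS x \in (linfun (sub_val subS) @: J)%VS.
  by rewrite -(lfunE (sub_val subS)) memv_img.
rewrite [(_ @: _)%VS]ssS.
- by rewrite !memv0 -(inj_eq (sub_val_inj subS)) linear0.
- by rewrite -[X in (_ <= X)%VS](limg_sub_val subS) limgS ?subvf.
- rewrite -[X in lie_prod X _](limg_sub_val subS) -(limg_lie_prod fm) limgS //.
  by apply/lie_prod_subP => u v _; apply: idJ.
- by exists 1%N; rewrite /= -(limg_lie_prod fm) J0 limg0.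
Qed.

Section Abelian.
Variables (F : fieldType) (V : vectType F).
(** The vector space V with zero bracket. *)
Definition abLie : Type := V.
HB.instance Definition _ := Vector.copy abLie V.
Definition ab_lie (x y : abLie) : abLie := 0.
Fact ab_linearl z : linear (ab_lie^~ z).
Proof. by move=> a x y; rewrite /ab_lie scaler0 addr0. Qed.
Fact ab_liexx x : ab_lie x x = 0. Proof. by []. Qed.
Fact ab_jacobi x y z :
  ab_lie x (ab_lie y z) + ab_lie y (ab_lie z x) + ab_lie z (ab_lie x y) = 0.
Proof. by rewrite /ab_lie !addr0. Qed.
HB.instance Definition _ := Lmodule_isLie.Build F abLie
  ab_linearl ab_linearl ab_liexx ab_jacobi.
Lemma ab_lieE (x y : abLie) : lie x y = 0. Proof. by []. Qed.
End Abelian.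

Section GeneralLinear.
Variables (F : fieldType) (n : nat).
(** Square matrices with the commutator bracket. *)
Definition glLie : Type := 'M[F]_n.
HB.instance Definition _ := Vector.copy glLie 'M[F]_n.
Definition gl_lie (A B : glLie) : glLie := (A : 'M_n) *m B - (B : 'M_n) *m A.
Fact gl_linearl D : linear (gl_lie^~ D).
Proof.
move=> a A B; rewrite /gl_lie mulmxDl mulmxDr -scalemxAl -scalemxAr.
by rewrite scalerBr opprD addrACA.
Qed.
Fact gl_linearr D : linear (gl_lie D).
Proof.
move=> a A B; rewrite /gl_lie mulmxDl mulmxDr -scalemxAl -scalemxAr.
by rewrite scalerBr opprD addrACA.
Qed.
Fact gl_liexx A : gl_lie A A = 0. Proof. exact: subrr. Qed.
Fact gl_jacobi A B D :
  gl_lie A (gl_lie B D) + gl_lie B (gl_lie D A) + gl_lie D (gl_lie A B) = 0.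
Proof.
rewrite /gl_lie !(mulmxBl, mulmxBr, mulmxA); vring.
Qed.
HB.instance Definition _ := Lmodule_isLie.Build F glLie
  gl_linearl gl_linearr gl_liexx gl_jacobi.
End GeneralLinear.

Definition derivation (F : fieldType) (L : lieType F) (D : L -> L) :=
  forall x y, D (lie x y) = lie (D x) y + lie x (D y).

(** An action of the Lie algebra A on the Lie algebra N by derivations. *)
Record lieAction (F : fieldType) (A N : lieType F) := LieAction {
  lie_act :> A -> {linear N -> N};
  lie_act_linear : forall x, linear (lie_act^~ x);
  lie_act_der : forall a, derivation (lie_act a);
  lie_act_lie : forall a b x,
    lie_act (lie a b) x = lie_act a (lie_act b x) - lie_act b (lie_act a x) }.

Section Semidirect.
Variables (F : fieldType) (A N : vectLieType F).
(** The semidirect product of A acting on N by rho; the type itself does not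
    depend on rho, only its bracket does. *)
Definition semidirect of lieAction A N : Type := (A * N)%type.
Variable rho : lieAction A N.
Local Notation sd := (semidirect rho).
HB.instance Definition _ := Vector.copy sd (A * N)%type.
Definition sd_lie (u v : sd) : sd :=
  (lie u.1 v.1, rho u.1 v.2 - rho v.1 u.2 + lie u.2 v.2).
Fact sd_liexx u : sd_lie u u = 0.
Proof. by rewrite /sd_lie !liexx subrr addr0. Qed.
Fact sd_linearl w : linear (sd_lie^~ w).
Proof.
move=> a u v; congr (_, _) => /=; first by rewrite lieDl lieZl.
by rewrite lie_act_linear lieDl lieZl linearP; vring.
Qed.
Fact sd_linearr w : linear (sd_lie w).
Proof.
move=> a u v; congr (_, _) => /=; first by rewrite lieDr lieZr.
by rewrite lie_act_linear lieDr lieZr linearP; vring.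
Qed.
Fact sd_jacobi u v w :
  sd_lie u (sd_lie v w) + sd_lie v (sd_lie w u) + sd_lie w (sd_lie u v) = 0.
Proof.
congr (_, _); rewrite /= ?lie_jacobi //.
rewrite !lie_act_lie !linearD !linearN /= !lie_act_der.
have := lie_jacobi u.2 v.2 w.2.
rewrite (lieC (rho u.1 v.2)) (lieC (rho v.1 w.2)) (lieC (rho w.1 u.2)) => jac.
by rewrite -[RHS]jac; vring.
Qed.
HB.instance Definition _ := Lmodule_isLie.Build F sd
  sd_linearl sd_linearr sd_liexx sd_jacobi.
Lemma sd_lieE (u v : sd) :
  lie u v = (lie u.1 v.1, rho u.1 v.2 - rho v.1 u.2 + lie u.2 v.2).
Proof. by []. Qed.
End Semidirect.

(** * The free nilpotent Lie algebra *)

Section FreeNil.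
Variables (F : fieldType) (X : finType) (t : nat).
Notation N := (freeNil F X t).

Lemma freeNil_ind (P : N -> Prop) :
  (forall x, P (fn_gen x)) -> (forall a u v, P u -> P v -> P (a *: u + v)) ->
  P 0 -> (forall u v, P u -> P v -> P (lie u v)) -> forall u, P u.
Proof.
move=> Pg Plin P0 Plie; elim/lie_proj_ind => x.
elim/freeLie_ind: x => [x||u v Pu Pv|a u Pu|u v Pu Pv].
- exact: Pg.
- by rewrite linear0.
- by rewrite linearD -[X in X + _]scale1r; apply: Plin.
- by rewrite linearZ /= -[_ *: _]addr0; apply: Plin.
- by rewrite lie_proj_morph; apply: Plie.
Qed.

Lemma lcs_freeNil : lcs N t.+1 = 0%VS.
Proof.
have lift k (u : N) : u \in lcs N k.+1 ->
    exists2 x, lcs_set k.+1 x & u = lie_proj (lcs_ideal (freeLie F X) t.+1) x.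
  elim: k u => [|k IH] u; first by elim/lie_proj_ind: u => x _; exists x.
  rewrite lcsS; move: u; apply: lie_prod_ind => [|a u v [x xk ->] [y yk ->]|u v _ vk].
  - by exists 0; [apply: lcs_set0 | rewrite linear0].
  - by exists (a *: x + y); [apply: lcs_setL | rewrite linearP].
  have [y yk ->] := IH v vk; elim/lie_proj_ind: u => x.
  by exists (lie x y); [apply: lcs_set_lie | rewrite lie_proj_morph].
apply/eqP; rewrite -subv0; apply/subvP => u /lift[x xt ->].
by rewrite memv0 lie_proj_eq0; apply/asboolP.
Qed.

(** The universal property: maps from the generators into a Lie algebra of
    nilindex at most t extend to morphisms. *)
Lemma freeNil_lift (L : vectLieType F) (f : X -> L) : lcs L t.+1 = 0%VS ->
  exists2 h : {linear N -> L}, lie_morph h & forall x, h (fn_gen x) = f x.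
Proof.
move=> Lt; have [g gm gE] := freeLie_lift f.
have gk k x : lcs_set k x -> g x \in lcs L k.
  case: k => [|k]; first by move=> _; apply: memvf.
  elim: k x => [|k IH] x; first by move=> _; apply: memvf.
  elim=> [|a _ y [u [v [vk ->]]] _ yk]; first by rewrite linear0 mem0v.
  by rewrite linearP rpredD ?rpredZ // gm; apply/mem_lcsS/IH.
pose h (u : N) := g (repr u).
have hE x : h (lie_proj _ x) = g x.
  apply/eqP; rewrite /h -subr_eq0 -linearB -memv0 -Lt.
  by apply: gk; apply/asboolP; apply: (lie_reprE (lcs_ideal _ t.+1) x).
have hlin : linear h.
  move=> a; elim/lie_proj_ind => x; elim/lie_proj_ind => y.
  by rewrite -linearP !hE linearP.
pose hL : {linear N -> L} := HB.pack h (GRing.isLinear.Build F N L *:%R h hlin).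
exists hL => [|x]; last by rewrite -gE -hE.
elim/lie_proj_ind => x; elim/lie_proj_ind => y.
by rewrite -lie_proj_morph /= !hE gm.
Qed.

Lemma derivation_freeNil_eq (D D' : {linear N -> N}) :
  derivation D -> derivation D' ->
  (forall x, D (fn_gen x) = D' (fn_gen x)) -> D =1 D'.
Proof.
move=> dD dD' gD; apply: freeNil_ind => // [a u v uD vD||u v uD vD].
- by rewrite !linearP uD vD.
- by rewrite !linear0.
- by rewrite dD dD' uD vD.
Qed.

Section Adjoint.
Variable L : vectLieType F.

Fact ad_act_linear (x : abLie L) : linear (fun y : L => lie y x : abLie L).
Proof. exact: lie_linearl. Qed.
Fact ad_act_der (y : L) : derivation (lie y : abLie L -> abLie L).
Proof. by move=> x z; rewrite !ab_lieE addr0 [LHS]lie0r. Qed.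
Fact ad_act_lie (a b : L) (x : abLie L) :
  (lie (lie a b) (x : L) : abLie L) = lie a (lie b (x : L)) - lie b (lie a (x : L)).
Proof. by rewrite (lie_leibniz a b) addrK. Qed.

(** L acting by ad on its own underlying space, taken abelian.  The semidirect
    product is L tensored with the dual numbers, and a morphism into it lifting
    the identity is the same as a derivation of L. *)
Definition ad_act : lieAction L (abLie L) :=
  @LieAction F L (abLie L) (fun y => (lie y : {linear L -> L}) : {linear abLie L -> abLie L}) ad_act_linear ad_act_der ad_act_lie.

Lemma lcs_ad_act k (u : semidirect ad_act) : u \in lcs (semidirect ad_act) k ->
  u.1 \in lcs L k /\ (u.2 : L) \in lcs L k.
Proof.
case: k => [|k]; first by move=> _; split; apply: memvf.
elim: k u => [|k IH] u; first by move=> _; split; apply: memvf.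
rewrite lcsS; move: u; apply: lie_prod_ind => [|a u v [u1 u2] [v1 v2]|u v _ /IH[v1 v2]].
- by split; apply: mem0v.
- by split; rewrite /= rpredD ?rpredZ.
split; first exact: mem_lcsS.
rewrite /= addr0; apply: rpredB; first exact: mem_lcsS.
by rewrite [X in X \in _]lieC memvN; apply: mem_lcsS.
Qed.
End Adjoint.

(** Every map on the generators extends to a derivation. *)
Lemma freeNil_derivation (g : X -> N) :
  exists2 D : {linear N -> N}, derivation D & forall x, D (fn_gen x) = g x.
Proof.
pose S := semidirect (ad_act N).
have St : lcs S t.+1 = 0%VS.
  apply/eqP; rewrite -subv0; apply/subvP => u /lcs_ad_act[].
  by rewrite lcs_freeNil !memv0; case: u => u1 u2 /= /eqP-> /eqP->.
have [h hm hE] := freeNil_lift (fun x => (fn_gen x, g x) : S) St.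
have h1 u : (h u).1 = u.
  elim/freeNil_ind: u => [x|a u v uE vE||u v uE vE]; first by rewrite hE.
  - by rewrite linearP /= uE vE.
  - by rewrite linear0.
  - by rewrite hm /= uE vE.
pose D u : N := (h u).2.
have Dlin : linear D by move=> a u v; rewrite /D linearP.
pose DL : {linear N -> N} := HB.pack D (GRing.isLinear.Build F N N *:%R D Dlin).
exists DL => [u v|x]; last by rewrite /= /D hE.
rewrite /= /D hm sd_lieE /= addr0 !h1 addrC; congr (_ + _).
by rewrite [RHS]lieC.
Qed.

End FreeNil.

(** * Derivations and filiform quotients of free nilpotent algebras *)

Section LinearDerivations.
Variables (F : fieldType) (n t : nat).
Notation N := (freeNil F 'I_n t).

(** The derivation of the free nilpotent Lie algebra whose restriction to the
    span of the generators has matrix A: generator j goes to column j of A. *)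
Definition gl_der (A : 'M[F]_n) : {linear N -> N} :=
  projT1 (cid2 (@freeNil_derivation F 'I_n t (fun j => \sum_i A i j *: fn_gen i))).

Lemma gl_der_der A : derivation (gl_der A).
Proof. by rewrite /gl_der; case: cid2. Qed.

Lemma gl_der_gen A j : gl_der A (fn_gen j) = \sum_i A i j *: fn_gen i.
Proof. by rewrite /gl_der; case: cid2. Qed.

Fact gl_der_linear x : linear (fun A : glLie F n => gl_der A x).
Proof.
move=> a A B; pose D := a \*: gl_der A \+ gl_der B.
have -> : a *: gl_der A x + gl_der B x = D x by [].
apply: derivation_freeNil_eq => [||j]; first exact: gl_der_der.
  by move=> y z; rewrite /D /= !gl_der_der lieDl lieDr lieZl lieZr scalerDr addrACA.
rewrite /D /= !gl_der_gen scaler_sumr -big_split; apply: eq_bigr => i _.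
by rewrite !mxE scalerDl scalerA.
Qed.

Fact gl_der_lie (A B : glLie F n) x :
  gl_der (lie A B) x = gl_der A (gl_der B x) - gl_der B (gl_der A x).
Proof.
pose D := (gl_der A \o gl_der B) \- (gl_der B \o gl_der A).
have -> : gl_der A (gl_der B x) - gl_der B (gl_der A x) = D x by [].
apply: derivation_freeNil_eq => [||j]; first exact: gl_der_der.
  move=> y z; rewrite /D /= !gl_der_der !linearD /= !gl_der_der lieBl !lieNr.
  by vring.
have DD (A' B' : 'M_n) : gl_der A' (gl_der B' (fn_gen j)) =
    \sum_k (A' *m B') k j *: fn_gen k.
  rewrite gl_der_gen linear_sum /=.
  under eq_bigr do rewrite linearZ /= gl_der_gen scaler_sumr.
  rewrite exchange_big /=; apply: eq_bigr => k _.
  rewrite mxE scaler_suml; apply: eq_bigr => i _.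
  by rewrite scalerA mulrC.
rewrite /D /= !DD -sumrB gl_der_gen; apply: eq_bigr => k _.
by rewrite -scalerBl !mxE.
Qed.

End LinearDerivations.

Lemma n2_ind (F : fieldType) t (P : n2 F t -> Prop) :
  P v0 -> P v1 -> (forall a u v, P u -> P v -> P (a *: u + v)) ->
  P 0 -> (forall u v, P u -> P v -> P (lie u v)) -> forall u, P u.
Proof.
move=> P0 P1; apply: freeNil_ind => x.
case: (unliftP ord_max x) => [j ->|->] //.
by rewrite (_ : lift _ _ = ord0) //; apply/val_inj; case: j => [[]].
Qed.

Section Filiform.
Variables (F : fieldType) (t : nat).

(** The nilpotent Jordan block of size t, acting on row vectors. *)
Definition shift_mx : 'M[F]_t := \matrix_(i, j) (j == i.+1 :> nat)%:R.
Definition shift_act (a : F) : 'rV[F]_t -> 'rV[F]_t := fun u => a *: (u *m shift_mx).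
Fact shift_act_linear a : linear (shift_act a).
Proof. by move=> b u v; rewrite /shift_act mulmxDl -scalemxAl scalerDr !scalerA mulrC. Qed.
HB.instance Definition _ a :=
  GRing.isLinear.Build F 'rV[F]_t 'rV[F]_t *:%R (shift_act a) (shift_act_linear a).

(** A scalar a acts as a times the Jordan block. *)
Definition filiform_act : lieAction (abLie F^o) (abLie 'rV[F]_t).
Proof.
apply: (@LieAction F (abLie F^o) (abLie 'rV[F]_t)
  (fun a => (shift_act a : {linear 'rV[F]_t -> 'rV[F]_t}))).
- by move=> u a x y; rewrite /= /shift_act scalerDl scalerA.
- by move=> a u v; rewrite !ab_lieE linear0 addr0.
- move=> a b u; rewrite /= /shift_act !ab_lieE scale0r -!scalemxAl !scalerA.
  by rewrite mulrC subrr.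
Defined.
(** The filiform Lie algebra of dimension t + 1: an abelian ideal of dimension t
    on which one more element acts as a nilpotent Jordan block.  Its role is to
    show that the t-th term of the lower central series of n2 F t is nonzero. *)
Definition filiform := semidirect filiform_act.
HB.instance Definition _ := VectLie.on filiform.

Lemma lcs_filiform k (u : filiform) : u \in lcs filiform k.+2 ->
  u.1 = 0 /\ forall j : 'I_t, (j < k.+1)%N -> (u.2 : 'rV_t) 0 j = 0.
Proof.
have shift0 (v : 'rV[F]_t) (j : 'I_t) : j = 0 :> nat -> (v *m shift_mx) 0 j = 0.
  move=> j0; rewrite mxE big1 // => i _.
  by rewrite !mxE j0 mulr0.
have sub0 a b (v w : 'rV[F]_t) (j : 'I_t) : j = 0 :> nat ->
    (shift_act a v - shift_act b w) 0 j = 0.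
  by move=> j0; rewrite mxE mxE shift0 // mulr0 mxE mxE shift0 // mulr0 subr0.
elim: k u => [|k IH] u; rewrite lcsS; move: u;
  apply: lie_prod_ind => [|a u v [u1 u2] [v1 v2]|u v _ vk].
- by split=> // j _; rewrite mxE.
- by split=> [|j j0]; rewrite /= ?u1 ?v1 ?scaler0 ?addr0 // !mxE u2 ?v2 // mulr0 addr0.
- split=> // j; rewrite ltnS leqn0 => /eqP j0.
  by rewrite /= addr0; apply: sub0.
- by split=> // j _; rewrite mxE.
- by split=> [|j j0]; rewrite /= ?u1 ?v1 ?scaler0 ?addr0 // !mxE u2 ?v2 // mulr0 addr0.
have [v1 v2] := IH _ vk; split=> // j jk.
rewrite /= addr0 v1 /shift_act scale0r subr0 !mxE big1 ?mulr0 // => i _.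
rewrite !mxE; have [ji|ji] := eqVneq (j : nat) i.+1; last by rewrite mulr0.
by rewrite v2 ?mul0r // -ltnS -ji.
Qed.

Lemma lcs_filiform0 : (0 < t)%N -> lcs filiform t.+1 = 0%VS.
Proof.
move=> t0; apply/eqP; rewrite -subv0; apply/subvP => u.
rewrite -{1}(prednK t0) => /lcs_filiform; case: u => a v [/= -> v0].
rewrite memv0 (_ : v = 0) //; apply/rowP => j; rewrite mxE; apply: v0.
by rewrite prednK.
Qed.

Lemma filiform_iter k (tk : (k < t)%N) :
  iter k (lie ((1, 0) : filiform)) ((0, delta_mx 0 (Ordinal (leq_ltn_trans (leq0n k) tk))) : filiform)
  = (0, delta_mx 0 (Ordinal tk)).
Proof.
elim: k tk => [|k IH] tk; first by congr (_, delta_mx _ _); apply: val_inj.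
rewrite iterS; have := IH (ltnW tk); rewrite (bool_irrelevance (leq_ltn_trans _ (ltnW tk)) (leq_ltn_trans (leq0n k.+1) tk)).
move=> ->; congr (_, _); rewrite /= /shift_act scale1r scale0r subr0 addr0.
apply/rowP => j; rewrite -rowE !mxE eqxx /=.
by rewrite -val_eqE.
Qed.
End Filiform.

(** In the filiform algebra, hence in n2 F t, the bracket with v0 can be applied
    t - 1 times to v1 without reaching 0. *)
Lemma lcs_n2_neq0 (F : fieldType) t : (0 < t)%N -> lcs (n2 F t) t != 0%VS.
Proof.
move=> t0.
pose g (j : 'I_2) : filiform F t :=
  if j == ord0 then (1, 0) else (0, delta_mx 0 (Ordinal t0)).
have [h hm hg] := freeNil_lift g (lcs_filiform0 F t0).
have hv0 : h v0 = (1, 0) by rewrite hg.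
have hv1 : h v1 = (0, delta_mx 0 (Ordinal t0)) by rewrite hg.
have tt : (t.-1 < t)%N by rewrite prednK.
have mem k : iter k (lie v0) v1 \in lcs (n2 F t) k.+1.
  by elim: k => [|k IH]; [apply: memvf | apply: mem_lcsS].
apply/negP => /eqP l0; have := mem t.-1; rewrite prednK // l0 memv0 => /eqP it0.
have hit k : h (iter k (lie v0) v1) = iter k (lie ((1, 0) : filiform F t)) (h v1).
  by elim: k => // k IH; rewrite !iterS hm IH hv0.
have := hit t.-1; rewrite it0 linear0 hv1.
have := filiform_iter F tt.
rewrite (bool_irrelevance (leq_ltn_trans _ tt) t0) => -> /(congr1 snd) /= /rowP.
by move/(_ (Ordinal tt)); rewrite !mxE !eqxx => /esym/eqP; rewrite oner_eq0.
Qed.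

(** The generators of n2 F t are independent modulo the derived algebra. *)
Lemma n2_gens_free (F : fieldType) t a b : (0 < t)%N ->
  a *: v0 + b *: v1 \in lcs (n2 F t) 2 -> a = 0 /\ b = 0.
Proof.
move=> t0; pose A := abLie 'rV[F]_2.
have A2 : lcs A 2 = 0%VS.
  apply/eqP; rewrite -subv0; apply/lie_prod_subP => x y _ _.
  by rewrite ab_lieE mem0v.
have At : lcs A t.+1 = 0%VS.
  by apply/eqP; rewrite -subv0 -A2 lcs_sub.
have [h hm hg] := freeNil_lift (fun j => delta_mx 0 j : A) At.
move=> /(mem_lcs_morph hm); rewrite A2 memv0 linearD !linearZ /= !hg => /eqP/rowP ab.
split; first by have := ab ord0; rewrite !mxE /= mulr1 mulr0 addr0.
by have := ab ord_max; rewrite !mxE /= mulr1 mulr0 add0r.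
Qed.

(** * Layers of the lower central series of a two-generated algebra *)

Section Layers.
Variables (F : fieldType) (L : vectLieType F).
Implicit Types (x y : L) (U V : {vspace L}).

(** Generators modulo lcs 2 and modulo lcs (k + 2) of lcs (k + 1) give, through
    their brackets, generators of the next layer. *)
Lemma lcs_layer U V k : (fullv <= U + lcs L 2)%VS ->
  (lcs L k.+1 <= V + lcs L k.+2)%VS ->
  (lcs L k.+2 <= lie_prod U V + lcs L k.+3)%VS.
Proof.
move=> /subvP LU /subvP kV; rewrite lcsS; apply/lie_prod_subP => x y /LU + yk.
move: (kV _ yk) => /memv_addP[v vV [y' y'k Ey]] /memv_addP[u uU [x' x'2 ->]].
rewrite lieDl {1}Ey lieDr -addrA; apply: memv_add; first exact: mem_lie_prod.
by apply: rpredD; [apply: mem_lcsS | apply: lcs2_lie].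
Qed.

Variables a0 a1 : L.

(** a0 and a1 span L modulo its derived algebra. *)
Definition generate2 := (fullv <= <<[:: a0; a1]>> + lcs L 2)%VS.

(** The iterated brackets of two elements, named as the basis of n2; gx1 is
    half of the element x1. *)
Definition gw := lie a0 a1.
Definition gz0 := lie a0 gw.
Definition gz1 := lie a1 gw.
Definition gx0 := lie a0 gz0.
Definition gx1 := lie a0 gz1.
Definition gx2 := lie a1 gz1.

Lemma gx1E : lie a1 gz0 = gx1.
Proof. by rewrite /gx1 /gz1 [RHS]lie_leibniz liexx add0r. Qed.

Hypothesis gen : generate2.

Lemma lcs2_gen : (lcs L 2 <= <<[:: gw]>> + lcs L 3)%VS.
Proof.
apply: subv_trans (@lcs_layer _ _ 0 gen gen) _; apply: addvS => //.
apply: lie_prod_span => u v; rewrite !inE => /orP[]/eqP-> /orP[]/eqP->.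
- by rewrite liexx mem0v.
- by rewrite memv_span ?mem_head.
- by rewrite lieC memvN memv_span ?mem_head.
- by rewrite liexx mem0v.
Qed.

Lemma lcs3_gen : (lcs L 3 <= <<[:: gz0; gz1]>> + lcs L 4)%VS.
Proof.
apply: subv_trans (lcs_layer gen lcs2_gen) _; apply: addvS => //.
apply: lie_prod_span => u v; rewrite !inE => /orP[]/eqP-> /eqP->;
  by rewrite memv_span ?inE ?eqxx ?orbT.
Qed.

Lemma lcs4_gen : (lcs L 4 <= <<[:: gx0; gx1; gx2]>> + lcs L 5)%VS.
Proof.
apply: subv_trans (lcs_layer gen lcs3_gen) _; apply: addvS => //.
apply: lie_prod_span => u v; rewrite !inE => /orP[]/eqP-> /orP[]/eqP->;
  by rewrite ?gx1E memv_span ?inE ?eqxx ?orbT.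
Qed.

Lemma gw_lcs : gw \in lcs L 2. Proof. exact: mem_lcs2. Qed.
Lemma gz0_lcs : gz0 \in lcs L 3. Proof. exact/mem_lcsS/gw_lcs. Qed.
Lemma gz1_lcs : gz1 \in lcs L 3. Proof. exact/mem_lcsS/gw_lcs. Qed.
Lemma gx0_lcs : gx0 \in lcs L 4. Proof. exact/mem_lcsS/gz0_lcs. Qed.
Lemma gx1_lcs : gx1 \in lcs L 4. Proof. exact/mem_lcsS/gz1_lcs. Qed.
Lemma gx2_lcs : gx2 \in lcs L 4. Proof. exact/mem_lcsS/gz1_lcs. Qed.

Lemma lcs1_genP x : exists c0 c1, x - (c0 *: a0 + c1 *: a1) \in lcs L 2.
Proof.
have := subvP gen x (memvf x); rewrite span_cons span_seq1 -addvA.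
move=> /memv_addP[_ /vlineP[c0 ->] [_ /memv_addP[_ /vlineP[c1 ->] [y y2 ->]] ->]].
by exists c0, c1; rewrite addrA [X in X - _]addrC addrK.
Qed.

Lemma lcs2_genP x : x \in lcs L 2 -> exists c, x - c *: gw \in lcs L 3.
Proof.
move/(subvP lcs2_gen); rewrite span_seq1 => /memv_addP[_ /vlineP[c ->] [y y2 ->]].
by exists c; rewrite [X in X - _]addrC addrK.
Qed.

Lemma lcs3_genP x : x \in lcs L 3 ->
  exists c0 c1, x - (c0 *: gz0 + c1 *: gz1) \in lcs L 4.
Proof.
move/(subvP lcs3_gen); rewrite span_cons span_seq1 -addvA.
move=> /memv_addP[_ /vlineP[c0 ->] [_ /memv_addP[_ /vlineP[c1 ->] [y y2 ->]] ->]].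
by exists c0, c1; rewrite addrA [X in X - _]addrC addrK.
Qed.

Lemma lcs4_genP x : x \in lcs L 4 ->
  exists c0 c1 c2, x - (c0 *: gx0 + c1 *: gx1 + c2 *: gx2) \in lcs L 5.
Proof.
move/(subvP lcs4_gen); rewrite !span_cons span_nil addv0 -!addvA.
move=> /memv_addP[_ /vlineP[c0 ->] [_ /memv_addP[_ /vlineP[c1 ->] [_ /memv_addP[_ /vlineP[c2 ->] [y y2 ->]] ->]] ->]].
by exists c0, c1, c2; rewrite !addrA [X in X - _]addrC addrK.
Qed.

End Layers.

Section DerMod.
Variables (F : fieldType) (L : vectLieType F) (D : {linear L -> L}).
Hypothesis dD : derivation D.

Lemma der_lcs k x : x \in lcs L k -> D x \in lcs L k.
Proof.
case: k => [|k]; first by move=> _; apply: memvf.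
elim: k x => [|k IH] x; first by move=> _; apply: memvf.
rewrite lcsS; move: x; apply: lie_prod_ind => [|a x y xk yk|x y _ yk].
- by rewrite linear0 mem0v.
- by rewrite linearP rpredD ?rpredZ.
- by rewrite dD rpredD // mem_lie_prod ?memvf ?IH.
Qed.

(** A derivation acts on the layers of the lower central series by the Leibniz
    rule, once its effect on each factor is known modulo the next layer. *)
Lemma der_mod k x x' y y' : D x - x' \in lcs L 2 -> y \in lcs L k.+1 ->
  D y - y' \in lcs L k.+2 -> D (lie x y) - (lie x' y + lie x y') \in lcs L k.+3.
Proof.
move=> xx' yk yy'; rewrite dD opprD addrACA -lieBl -lieBr.
by apply: rpredD; [apply: lcs2_lie | apply: mem_lcsS].
Qed.

(* Modulo lcs 2, D sends a0 to q a1 and a1 to r a0. *)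
Variables (a0 a1 : L) (q r : F).
Hypotheses (D0 : D a0 - q *: a1 \in lcs L 2) (D1 : D a1 - r *: a0 \in lcs L 2).

Let gw := gw a0 a1.
Let gz0 := gz0 a0 a1.
Let gz1 := gz1 a0 a1.
Let gx0 := gx0 a0 a1.
Let gx1 := gx1 a0 a1.
Let gx2 := gx2 a0 a1.

Lemma der_gw : D gw - 0 \in lcs L 3.
Proof.
have := @der_mod 0 _ _ _ _ D0 (memvf _) D1.
by rewrite lieZl lieZr !liexx !scaler0 addr0.
Qed.

Lemma der_gz0 : D gz0 - q *: gz1 \in lcs L 4.
Proof.
have := der_mod D0 (gw_lcs _ _) der_gw.
by rewrite lie0r addr0 lieZl.
Qed.

Lemma der_gz1 : D gz1 - r *: gz0 \in lcs L 4.
Proof.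
have := der_mod D1 (gw_lcs _ _) der_gw.
by rewrite lie0r addr0 lieZl.
Qed.

Lemma der_gx0 : D gx0 - (2 * q) *: gx1 \in lcs L 5.
Proof.
have := der_mod D0 (gz0_lcs _ _) der_gz0.
by rewrite lieZl lieZr gx1E -scalerDl -mulr2n mulr_natl.
Qed.

Lemma der_gx1 : D gx1 - (q *: gx2 + r *: gx0) \in lcs L 5.
Proof.
have := der_mod D0 (gz1_lcs _ _) der_gz1.
by rewrite lieZl lieZr.
Qed.

Lemma der_gx2 : D gx2 - (2 * r) *: gx1 \in lcs L 5.
Proof.
have := der_mod D1 (gz1_lcs _ _) der_gz1.
by rewrite lieZl lieZr gx1E -scalerDl -mulr2n mulr_natl.
Qed.

(** A relation of degree 3, or of degree 4, is mapped by D to another one. *)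
Lemma der_relZ c0 c1 : c0 *: gz0 + c1 *: gz1 \in lcs L 4 ->
  (c0 * q) *: gz1 + (c1 * r) *: gz0 \in lcs L 4.
Proof.
move/der_lcs; rewrite linearD !linearZ /= => h.
rewrite -!scalerA -[X in X \in _](subrK (c0 *: D gz0 + c1 *: D gz1)) rpredD //.
rewrite opprD addrACA -!scalerBr -![_ - D _]opprB.
by rewrite rpredD ?rpredZ // memvN ?der_gz0 ?der_gz1.
Qed.

Lemma der_relX c0 c1 c2 : c0 *: gx0 + c1 *: gx1 + c2 *: gx2 \in lcs L 5 ->
  (c1 * r) *: gx0 + (c0 * (2 * q) + c2 * (2 * r)) *: gx1 + (c1 * q) *: gx2 \in lcs L 5.
Proof.
move/der_lcs; rewrite !linearD !linearZ /= => h.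
have -> : (c1 * r) *: gx0 + (c0 * (2 * q) + c2 * (2 * r)) *: gx1 + (c1 * q) *: gx2
  = c0 *: ((2 * q) *: gx1) + c1 *: (q *: gx2 + r *: gx0) + c2 *: ((2 * r) *: gx1).
  by vring.
rewrite -[X in X \in _](subrK (c0 *: D gx0 + c1 *: D gx1 + c2 *: D gx2)) rpredD //.
rewrite !opprD addrACA -scalerBr [X in X + _]addrACA -!scalerBr -![_ - D _]opprB.
by rewrite !rpredD ?rpredZ // memvN ?der_gx0 ?der_gx1 ?der_gx2.
Qed.

End DerMod.

Section Collapse.
Variables (F : fieldType) (L : vectLieType F) (a0 a1 : L).
Hypotheses (nz2 : (2 : F) != 0) (gen : generate2 a0 a1).

(** Two derivations acting on the span of a0, a1 modulo lcs 2 as the raising and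
    lowering matrices of sl2. *)
Definition sl2_pair := exists E G : {linear L -> L},
  [/\ derivation E, derivation G,
      E a0 \in lcs L 2 /\ E a1 - a0 \in lcs L 2
    & G a0 - a1 \in lcs L 2 /\ G a1 \in lcs L 2].

Hypothesis pair : sl2_pair.

Lemma scalev_mem (U : {vspace L}) c x : c != 0 -> c *: x \in U -> x \in U.
Proof. by move=> c0 /(memvZ c^-1); rewrite scalerA mulVf // scale1r. Qed.

(** Under a pair of raising and lowering derivations, a layer of the lower
    central series is an irreducible sl2-module or zero: one nontrivial relation
    among its generators, raised and lowered, kills the whole layer.  Hence the
    generators of degree 2, 3, 4 are independent in each nonzero layer. *)
Lemma gw_indep c : lcs L 3 <> lcs L 2 -> c *: gw a0 a1 \in lcs L 3 -> c = 0.
Proof.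
move=> L32 cW; apply/eqP/contraT => c0; case: L32.
apply/eqP; rewrite eqEsubv lcs_subS (subv_trans (lcs2_gen gen)) // subv_add subvv andbT.
by rewrite span_seq1 -memvE (scalev_mem c0).
Qed.

Lemma gz_indep c0 c1 : lcs L 4 <> lcs L 3 ->
  c0 *: gz0 a0 a1 + c1 *: gz1 a0 a1 \in lcs L 4 -> c0 = 0 /\ c1 = 0.
Proof.
move=> L43 rel; have [E [G [dE dG [E0 E1] [G0 G1]]]] := pair.
have eE d0 d1 : d0 *: gz0 a0 a1 + d1 *: gz1 a0 a1 \in lcs L 4 -> d1 *: gz0 a0 a1 \in lcs L 4.
  have := @der_relZ _ _ E dE a0 a1 0 1 _ _ d0 d1.
  rewrite (scale0r a1) (scale1r a0) subr0 => /(_ E0 E1) h /h.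
  by rewrite mulr0 mulr1 scale0r add0r.
have eG d0 d1 : d0 *: gz0 a0 a1 + d1 *: gz1 a0 a1 \in lcs L 4 -> d0 *: gz1 a0 a1 \in lcs L 4.
  have := @der_relZ _ _ G dG a0 a1 1 0 _ _ d0 d1.
  rewrite (scale0r a0) (scale1r a1) subr0 => /(_ G0 G1) h /h.
  by rewrite mulr0 mulr1 scale0r addr0.
have z0nin : ~ gz0 a0 a1 \in lcs L 4.
  move=> z0; apply: L43; apply/eqP; rewrite eqEsubv lcs_subS (subv_trans (lcs3_gen gen)) //.
  rewrite subv_add subvv andbT span_cons span_seq1 subv_add -!memvE z0 /=.
  by have := eG 1 0; rewrite scale0r addr0 !scale1r => /(_ z0).
have c10 : c1 = 0.
  by apply/eqP/contraT => c10; case: z0nin; apply: (scalev_mem c10); apply: eE rel.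
split=> //; apply/eqP/contraT => c00; case: z0nin; apply: (scalev_mem c00).
by move: rel; rewrite c10 scale0r addr0.
Qed.

Lemma gx_indep c0 c1 c2 : lcs L 5 <> lcs L 4 ->
  c0 *: gx0 a0 a1 + c1 *: gx1 a0 a1 + c2 *: gx2 a0 a1 \in lcs L 5 ->
  [/\ c0 = 0, c1 = 0 & c2 = 0].
Proof.
move=> L54 rel; have [E [G [dE dG [E0 E1] [G0 G1]]]] := pair.
have eE d0 d1 d2 : d0 *: gx0 a0 a1 + d1 *: gx1 a0 a1 + d2 *: gx2 a0 a1 \in lcs L 5 ->
    d1 *: gx0 a0 a1 + (d2 * 2) *: gx1 a0 a1 + 0 *: gx2 a0 a1 \in lcs L 5.
  have := @der_relX _ _ E dE a0 a1 0 1 _ _ d0 d1 d2.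
  rewrite (scale0r a1) (scale1r a0) subr0 => /(_ E0 E1) h /h.
  by rewrite !mulr0 !mulr1 add0r.
have eG d0 d1 d2 : d0 *: gx0 a0 a1 + d1 *: gx1 a0 a1 + d2 *: gx2 a0 a1 \in lcs L 5 ->
    0 *: gx0 a0 a1 + (d0 * 2) *: gx1 a0 a1 + d1 *: gx2 a0 a1 \in lcs L 5.
  have := @der_relX _ _ G dG a0 a1 1 0 _ _ d0 d1 d2.
  rewrite (scale0r a0) (scale1r a1) subr0 => /(_ G0 G1) h /h.
  by rewrite !mulr0 !mulr1 addr0.
have x0nin : ~ gx0 a0 a1 \in lcs L 5.
  move=> x0; apply: L54; apply/eqP; rewrite eqEsubv lcs_subS (subv_trans (lcs4_gen gen)) //.
  have /eG x1 : 1 *: gx0 a0 a1 + 0 *: gx1 a0 a1 + 0 *: gx2 a0 a1 \in lcs L 5.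
    by rewrite !scale0r !addr0 scale1r.
  have /eG x2 := x1; move: x1 x2; rewrite !scale0r !add0r addr0 mul0r scale0r add0r mul1r.
  move=> /(scalev_mem nz2) x1 /(scalev_mem nz2) x2.
  by rewrite subv_add subvv andbT !span_cons span_nil addv0 !subv_add -!memvE x0 x1 x2.
have nin0 c : c *: gx0 a0 a1 \in lcs L 5 -> c = 0.
  by move=> cx; apply/eqP/contraT => cn; case: x0nin; apply: (scalev_mem cn).
have rel1 := eE _ _ _ rel; have rel2 := eE _ _ _ rel1.
have c20 : c2 = 0.
  move: rel2; rewrite mul0r !scale0r !addr0 => /nin0/eqP.
  by rewrite mulf_eq0 (negPf nz2) orbF => /eqP.
have c10 : c1 = 0 by move: rel1; rewrite c20 mul0r !scale0r !addr0 => /nin0.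
by split=> //; move: rel; rewrite c20 c10 !scale0r !addr0 => /nin0.
Qed.

End Collapse.

Lemma n2_generate (F : fieldType) t : generate2 (v0 : n2 F t) v1.
Proof.
apply/subvP => x _; have sp : (<<[:: v0; v1]>> <= <<[:: v0; v1]>> + lcs (n2 F t) 2)%VS.
  exact: addvSl.
move: x; apply: n2_ind => [||a u v uV vV||u v _ _].
- by apply: (subvP sp); rewrite memv_span ?mem_head.
- by apply: (subvP sp); rewrite memv_span ?inE ?eqxx ?orbT.
- by rewrite rpredD ?rpredZ.
- exact: mem0v.
- exact/(subvP (addvSr _ _))/mem_lcs2.
Qed.

Lemma n2_sl2_pair (F : fieldType) t : sl2_pair (v0 : n2 F t) v1.
Proof.
exists (gl_der t (delta_mx ord0 ord_max)), (gl_der t (delta_mx ord_max ord0)).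
have dv (A : 'M[F]_2) j : gl_der t A (fn_gen j) = A ord0 j *: v0 + A ord_max j *: v1.
  rewrite gl_der_gen big_ord_recl big_ord1.
  by have -> : lift ord0 ord0 = ord_max :> 'I_2 by apply: val_inj.
split; [exact: gl_der_der|exact: gl_der_der| |];
  by rewrite !dv !mxE /= ?scale0r ?scale1r ?add0r ?addr0 ?subrr ?mem0v.
Qed.

Lemma lcs_n2_3 (F : fieldType) : lcs (n2 F 3) 3 = <<[:: z0; z1]>>%VS.
Proof.
apply/eqP; rewrite eqEsubv; apply/andP; split.
  by have := lcs3_gen (n2_generate F 3); rewrite lcs_freeNil addv0.
by apply/span_subvP => x; rewrite !inE => /orP[]/eqP->; [apply: gz0_lcs|apply: gz1_lcs].
Qed.

(** * The listed quotients have type 2 and nilindex at most 4 *)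

Lemma free2P (F : fieldType) (V : vectType F) (x y : V) :
  reflect (forall a b, a *: x + b *: y = 0 -> a = 0 /\ b = 0) (free [:: x; y]).
Proof.
rewrite free_cons seq1_free span_seq1; apply: (iffP andP) => [[xy y0] a b ab|ab].
  have a0 : a = 0.
    apply/eqP/contraT => a0; case/negP: xy; apply/vlineP; exists (- (b / a)).
    move/eqP: ab; rewrite addr_eq0 => /eqP ab; apply: (scalerI a0).
    by rewrite ab scalerA mulrN mulrC divfK // scaleNr.
  split=> //; move/eqP: ab; rewrite a0 scale0r add0r scaler_eq0 (negPf y0) orbF.
  by move/eqP.
split; apply/negP.
  case/vlineP => k xk; have [] := ab 1 (- k); last by move/eqP; rewrite oner_eq0.
  by rewrite xk scale1r scaleNr subrr.
move=> /eqP y0; have [] := ab 0 1; last by move=> _ /eqP; rewrite oner_eq0.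
by rewrite y0 scaler0 scale0r addr0.
Qed.

Section Generators.
Variables (F : fieldType) (L : vectLieType F).

(** a0 and a1 are independent modulo the derived algebra. *)
Definition free_mod2 (a0 a1 : L) :=
  forall c0 c1, c0 *: a0 + c1 *: a1 \in lcs L 2 -> c0 = 0 /\ c1 = 0.

Lemma nil_type2_gens : nil_type L = 2%N ->
  exists a0 a1 : L, generate2 a0 a1 /\ free_mod2 a0 a1.
Proof.
move=> nt; pose V := ((lcs L 2)^C)%VS.
have dV : \dim V = 2%N by rewrite dimv_compl.
have sV : size (vbasis V) = 2%N by rewrite size_tuple.
have := vbasisP V; move: sV; case: (tval (vbasis V)) => [|a0 [|a1 [|]]] // _ aV.
exists a0, a1; split.
  by rewrite /generate2 (span_basis aV) addvC addv_complf.
move=> c0 c1 c2; have /free2P := basis_free aV; apply.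
apply/eqP; rewrite -memv0 -(capv_compl (lcs L 2)) memv_cap c2 /=.
rewrite -/V -(span_basis aV) span_cons span_seq1.
by apply: memv_add; apply/vlineP; [exists c0|exists c1].
Qed.

Lemma gens_nil_type2 (a0 a1 : L) :
  generate2 a0 a1 -> free_mod2 a0 a1 -> nil_type L = 2%N.
Proof.
move=> gen fr; rewrite /nil_type.
have -> : fullv = (<<[:: a0; a1]>> + lcs L 2)%VS.
  by apply/eqP; rewrite eqEsubv subvf andbT.
have fr2 : free [:: a0; a1].
  by apply/free2P => a b ab; apply: fr; rewrite ab mem0v.
rewrite dimv_disjoint_sum; last first.
  apply/eqP; rewrite -subv0; apply/subvP => x /memv_capP[].
  rewrite span_cons span_seq1.
  move=> /memv_addP[_ /vlineP[c0 ->] [_ /vlineP[c1 ->] ->]] /fr[-> ->].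
  by rewrite !scale0r addr0 mem0v.
by rewrite addnK; move/eqP: fr2.
Qed.

(** A morphism is onto as soon as it is so modulo the derived algebra of a
    nilpotent target. *)
Lemma generate2_surj (M : vectLieType F) (f : {linear M -> L}) (a0 a1 : L) t :
  lie_morph f -> a0 \in limg (linfun f) -> a1 \in limg (linfun f) ->
  generate2 a0 a1 -> lcs L t.+1 = 0%VS -> limg (linfun f) = fullv.
Proof.
move=> fm a0U a1U gen Lt; set U := limg _.
have genU : (fullv <= U + lcs L 2)%VS.
  apply: subv_trans gen _; apply: addvS => //.
  by apply/span_subvP => x; rewrite !inE => /orP[]/eqP->.
have subU : (lie_prod U U <= U)%VS by rewrite -limg_lie_prod // limgS ?subvf.
have step k : (lcs L k.+1 <= U + lcs L k.+2)%VS.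
  elim: k => // k IH; apply: subv_trans (lcs_layer genU IH) _.
  exact: addvS.
have all k : (fullv <= U + lcs L k.+1)%VS.
  elim: k => [|k IH]; first exact: addvSr.
  by apply: subv_trans IH _; rewrite subv_add addvSl step.
by apply/eqP; rewrite eqEsubv subvf; have := all t; rewrite Lt addv0.
Qed.

Lemma nilindex_lcs t k : nilindex L t -> (0 < k <= t)%N ->
  lcs L k.+1 <> lcs L k.
Proof.
move=> /andP[Lt /eqP Lt1] /andP[k0 kt]; case: k k0 kt => // k _ kt E.
by case/negP: Lt; rewrite (lcs_stable E) // -(lcs_stable (j := t.+1) E) ?Lt1 // ltnW.
Qed.

Lemma nilindex_gt0 t : nilindex L t -> (0 < t)%N.
Proof. by case: t => // /andP[h /eqP E]; rewrite -[lcs L 0]/(lcs L 1) E eqxx in h. Qed.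

End Generators.

Section QuotientLcs.
Variables (F : fieldType) (L : vectLieType F) (I : {vspace L}) (idI : is_ideal I).
Notation Q := (lie_quot (vs_ideal idI)).
Let pr := lie_proj (vs_ideal idI).

Lemma limg_lie_proj : limg (linfun pr) = fullv.
Proof.
apply/vspaceP => u; rewrite memvf; elim/lie_proj_ind: u => x.
by rewrite -(lfunE pr) memv_img ?memvf.
Qed.

Lemma lker_lie_proj : lker (linfun pr) = I.
Proof. by apply/vspaceP => x; rewrite memv_ker lfunE /= lie_proj_eq0. Qed.

Lemma lcs_quot k : lcs Q k = (linfun pr @: lcs L k)%VS.
Proof. by rewrite limg_lcs ?limg_lie_proj //; apply: lie_proj_morph. Qed.

Lemma lcs_quot_eq0 k : (lcs Q k == 0%VS) = (lcs L k <= I)%VS.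
Proof. by rewrite lcs_quot -lkerE lker_lie_proj. Qed.

Lemma quot_nilindex t : lcs L t.+1 = 0%VS -> ~~ (lcs L t <= I)%VS -> nilindex Q t.
Proof. by move=> Lt It; rewrite /nilindex !lcs_quot_eq0 It Lt sub0v. Qed.

Lemma quot_nil_type : (I <= lcs L 2)%VS -> nil_type Q = nil_type L.
Proof.
move=> I2; rewrite /nil_type lcs_quot -(limg_ker_dim (linfun pr) {:L}).
rewrite -(limg_ker_dim (linfun pr) (lcs L 2)) lker_lie_proj limg_lie_proj.
by rewrite capfv (capv_idPr I2) subnDl.
Qed.
End QuotientLcs.

Section N2.
Variables (F : fieldType) (nz2 : (2 : F) != 0).

Lemma n2_nilindex t : (0 < t)%N -> nilindex (n2 F t) t.
Proof. by move=> t0; rewrite /nilindex lcs_n2_neq0 // lcs_freeNil eqxx. Qed.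

Lemma n2_nil_type t : (0 < t)%N -> nil_type (n2 F t) = 2%N.
Proof.
move=> t0; apply: gens_nil_type2 (n2_generate F t) _ => a b.
exact: n2_gens_free.
Qed.

Lemma lcs_n2_4 : lcs (n2 F 4) 4 = <<[:: x0; x1; x2]>>%VS.
Proof.
apply/eqP; rewrite eqEsubv; apply/andP; split.
  have := lcs4_gen (n2_generate F 4); rewrite lcs_freeNil addv0 => /subv_trans; apply.
  apply/span_subvP => x; rewrite !inE => /or3P[]/eqP->.
  - by rewrite memv_span ?mem_head.
  - by apply: (scalev_mem nz2); rewrite memv_span ?inE ?eqxx ?orbT.
  - by rewrite memv_span ?inE ?eqxx ?orbT.
apply/span_subvP => x; rewrite !inE => /or3P[]/eqP->;
  [exact: gx0_lcs | by rewrite rpredZ // gx1_lcs | exact: gx2_lcs].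
Qed.

Lemma n2_z_indep t a b : (2 < t)%N ->
  a *: z0 + b *: z1 \in lcs (n2 F t) 4 -> a = 0 /\ b = 0.
Proof.
move=> t2; apply: (gz_indep (n2_generate F t) (n2_sl2_pair F t)).
by apply: (nilindex_lcs (n2_nilindex _)); rewrite // (ltn_trans _ t2).
Qed.

Lemma n2_x_indep a b c : a *: x0 + b *: x1 + c *: x2 = 0 :> n2 F 4 ->
  [/\ a = 0, b = 0 & c = 0].
Proof.
rewrite /x1 scalerA => abc.
have [||->] := gx_indep (c0 := a) (c1 := b * 2) (c2 := c) nz2 (n2_generate F 4) (n2_sl2_pair F 4).
- exact: (nilindex_lcs (n2_nilindex _)).
- by rewrite [X in X \in _]abc mem0v.
by move=> /eqP; rewrite mulf_eq0 (negPf nz2) orbF => /eqP-> ->.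
Qed.

Lemma dim_lcs_n2_3 : \dim (lcs (n2 F 3) 3) = 2%N.
Proof.
rewrite lcs_n2_3; apply/eqP; rewrite -/(free _); apply/free2P => a b ab.
by apply: (@n2_z_indep 3) => //; rewrite ab mem0v.
Qed.

Lemma dim_lcs_n2_4 : \dim (lcs (n2 F 4) 4) = 3%N.
Proof.
rewrite lcs_n2_4; apply/eqP; rewrite -/(free _) free_cons; apply/andP; split.
  apply/negP; rewrite span_cons span_seq1.
  move=> /memv_addP[_ /vlineP[b ->] [_ /vlineP[c ->] E]].
  have [|/eqP + _ _] := @n2_x_indep 1 (- b) (- c); last by rewrite oner_eq0.
  by rewrite E; vring.
apply/free2P => b c bc; have [|_ -> ->] := @n2_x_indep 0 b c => //.
by rewrite scale0r add0r.
Qed.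

Lemma n2_lie_lcs_le t k (x g : n2 F t) (J : {vspace n2 F t}) : (t <= k)%N ->
  g \in lcs (n2 F t) k -> lie x g \in J.
Proof.
move=> tk gk; have -> : lie x g = 0; last exact: mem0v.
apply/eqP; rewrite -memv0 -(lcs_freeNil F 'I_2 t).
apply: (subvP (lcs_sub _ (_ : (t.+1 <= k.+1)%N))) => //.
by case: k tk gk => [|k] tk gk; [apply: memvf | apply: mem_lcsS].
Qed.

(** A subspace of lcs 3 is an ideal once it is stable under the two generators,
    since the derived algebra kills lcs 3. *)
Lemma n2_4_idealP (J : {vspace n2 F 4}) : (J <= lcs (n2 F 4) 3)%VS ->
  (forall g, g \in J -> lie v0 g \in J /\ lie v1 g \in J) -> is_ideal J.
Proof.
move=> /subvP J3 Jv; apply/idealP => x g gJ.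
have [a [b xab]] := lcs1_genP (n2_generate F 4) x.
rewrite -[x](subrK (a *: v0 + b *: v1)) lieDl [X in _ + X]lieDl !lieZl.
have [g0 g1] := Jv g gJ; rewrite rpredD ?rpredD ?rpredZ //.
have -> : lie (x - (a *: v0 + b *: v1)) g = 0; last exact: mem0v.
apply/eqP; rewrite -memv0 -(lcs_freeNil F 'I_2 4).
by apply: lcs2_lie xab _; apply: J3.
Qed.

Lemma span_lie_stable (X : seq (n2 F 4)) (J : {vspace n2 F 4}) y :
  (forall g, g \in X -> lie y g \in J) -> forall g, g \in <<X>>%VS -> lie y g \in J.
Proof.
move=> Xy; apply: span_ind => [|a u v uJ vJ|//]; first by rewrite lie0r mem0v.
by rewrite lieDr lieZr rpredD ?rpredZ.
Qed.

Lemma n2_4_brackets :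
  [/\ lie v0 z0 = x0 :> n2 F 4, lie v0 z1 = 2^-1 *: x1 :> n2 F 4,
      lie v1 z0 = 2^-1 *: x1 :> n2 F 4 & lie v1 z1 = x2 :> n2 F 4].
Proof.
have e : lie v0 z1 = 2^-1 *: x1 :> n2 F 4 by rewrite /x1 scalerA mulVf // scale1r.
by split; rewrite // lie_v1_z0.
Qed.

Lemma n2_4_lie_x y : [/\ lie y x0 = 0 :> n2 F 4, lie y x1 = 0 :> n2 F 4 & lie y x2 = 0 :> n2 F 4].
Proof.
split; apply/eqP; rewrite -memv0; apply: (@n2_lie_lcs_le 4 4) => //;
  rewrite ?gx0_lcs ?gx2_lcs // rpredZ // gx1_lcs.
exact.
Qed.

Lemma halfr (V : lmodType F) a (x y : V) :
  2 *: (x + a *: (2^-1 *: y)) = 2 *: x + a *: y.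
Proof. by rewrite scalerDr !scalerA mulrCA mulfV // mulr1. Qed.

Lemma halfl (V : lmodType F) a (x y : V) :
  2 *: (2^-1 *: x + a *: y) = x + (2 * a) *: y.
Proof. by rewrite scalerDr !scalerA mulfV // scale1r. Qed.

Lemma ideal_b_lcs (I : {vspace n2 F 3}) :
  ideal_b I -> [/\ is_ideal I, (I <= lcs (n2 F 3) 2)%VS & ~~ (lcs (n2 F 3) 3 <= I)%VS].
Proof.
move=> [I3 dI]; split.
- by apply/idealP => x y /(subvP I3); apply: n2_lie_lcs_le.
- exact: subv_trans I3 (lcs_subS _ _).
- by apply/negP => /dimvS; rewrite dim_lcs_n2_3 dI.
Qed.

Lemma ideal_c_lcs (I : {vspace n2 F 4}) :
  ideal_c I -> [/\ is_ideal I, (I <= lcs (n2 F 4) 2)%VS & ~~ (lcs (n2 F 4) 4 <= I)%VS].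
Proof.
have [b00 b01 b10 b11] := n2_4_brackets.
have [x03 x13 x23] : [/\ x0 \in lcs (n2 F 4) 3, x1 \in lcs (n2 F 4) 3 & x2 \in lcs (n2 F 4) 3].
  by split; apply: (subvP (lcs_subS _ 3)); rewrite ?rpredZ ?gx0_lcs ?gx1_lcs ?gx2_lcs.
have z03 : z0 \in lcs (n2 F 4) 3 by apply: gz0_lcs.
have z13 : z1 \in lcs (n2 F 4) 3 by apply: gz1_lcs.
(* If a span of three vectors contained the 3-dimensional lcs 4, it would be
   equal to it, and could not contain an element outside lcs 4. *)
have notin (X : seq (n2 F 4)) a b (m : n2 F 4) : size X = 3%N ->
    a *: z0 + b *: z1 + m \in <<X>>%VS -> m \in lcs (n2 F 4) 4 ->
    (a, b) != (0, 0) -> ~~ (lcs (n2 F 4) 4 <= <<X>>)%VS.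
  move=> sX zX m4 ab0; apply/negP => XI.
  have E : lcs (n2 F 4) 4 = <<X>>%VS.
    by apply/eqP; rewrite eqEdim XI dim_lcs_n2_4 (leq_trans (dim_span X)) ?sX.
  move: zX; rewrite -E rpredDr // => /n2_z_indep [] // a0 b0.
  by move: ab0; rewrite a0 b0 eqxx.
case=> [I4 dI|al ->|al be ->].
- split; last 1 first.
  + by apply/negP => /dimvS; rewrite dim_lcs_n2_4; case: dI => ->.
  + by apply/idealP => x y /(subvP I4); apply: n2_lie_lcs_le.
  + exact: subv_trans I4 (lcs_sub _ _).
- set X := [:: _; _; _].
  have X3 : (<<X>> <= lcs (n2 F 4) 3)%VS.
    by apply/span_subvP => x; rewrite !inE => /or3P[]/eqP->;
      do ![by [] | apply: rpredD | apply: rpredZ].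
  split; last 1 first.
  + apply: (notin X 0 1 (al *: x0)) => //.
    * by rewrite scale0r add0r scale1r memv_span ?mem_head.
    * by rewrite rpredZ ?gx0_lcs.
    * by rewrite xpair_eqE oner_eq0 andbF.
  + have [x1X x2X] : x1 \in <<X>>%VS /\ x2 \in <<X>>%VS.
      by split; rewrite memv_span ?inE ?eqxx ?orbT.
    apply: n2_4_idealP => // g gX; split; move: g gX; apply: span_lie_stable => g.
      have [e0 e1 e2] := n2_4_lie_x v0.
      rewrite !inE => /or3P[]/eqP->; rewrite ?e1 ?e2 ?mem0v // lieDr lieZr e0.
      by rewrite b01 scaler0 addr0 rpredZ.
    have [e0 e1 e2] := n2_4_lie_x v1.
    rewrite !inE => /or3P[]/eqP->; rewrite ?e1 ?e2 ?mem0v // lieDr lieZr e0.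
    by rewrite b11 scaler0 addr0.
  + exact: subv_trans X3 (lcs_subS _ _).
- set X := [:: _; _; _].
  have X3 : (<<X>> <= lcs (n2 F 4) 3)%VS.
    by apply/span_subvP => x; rewrite !inE => /or3P[]/eqP->;
      do ![by [] | apply: rpredD | apply: rpredZ].
  split; last 1 first.
  + apply: (notin X 1 al (be *: x2)) => //.
    * by rewrite scale1r memv_span ?mem_head.
    * by rewrite rpredZ ?gx2_lcs.
    * by rewrite xpair_eqE oner_eq0.
  + have [AX BX] : 2 *: x0 + al *: x1 \in <<X>>%VS /\ x1 + (2 * al) *: x2 \in <<X>>%VS.
      by split; rewrite memv_span ?inE ?eqxx ?orbT.
    apply: n2_4_idealP => // g gX; split; move: g gX; apply: span_lie_stable => g.
      have [e0 e1 e2] := n2_4_lie_x v0.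
      rewrite !inE => /or3P[]/eqP->;
        rewrite !lieDr !(lieZr _ _ x0, lieZr _ _ x1, lieZr _ _ x2, lieZr _ _ z1) ?e0 ?e1 ?e2 ?scaler0 ?addr0 ?mem0v //.
      rewrite b00 b01; apply: (scalev_mem nz2).
      by rewrite halfr.
    have [e0 e1 e2] := n2_4_lie_x v1.
    rewrite !inE => /or3P[]/eqP->;
        rewrite !lieDr !(lieZr _ _ x0, lieZr _ _ x1, lieZr _ _ x2, lieZr _ _ z1) ?e0 ?e1 ?e2 ?scaler0 ?addr0 ?mem0v //.
    rewrite b10 b11; apply: (scalev_mem nz2).
    by rewrite halfl.
  + exact: subv_trans X3 (lcs_subS _ _).
Qed.

Lemma listed_type (L : vectLieType F) : listed L ->
  nil_type L = 2%N /\ exists2 t, (t <= 4)%N & nilindex L t.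
Proof.
case=> [[t /andP[t0 t4] iso]|[I Ib [idI iso]]|[I Ic [idI iso]]].
- rewrite (lie_iso_nil_type iso) n2_nil_type //; split=> //.
  by exists t; rewrite // (lie_iso_nilindex _ iso) n2_nilindex.
- have [_ I2 I3] := ideal_b_lcs Ib.
  rewrite (lie_iso_nil_type iso) quot_nil_type // n2_nil_type //; split=> //.
  by exists 3%N; rewrite // (lie_iso_nilindex _ iso) quot_nilindex ?lcs_freeNil.
- have [_ I2 I3] := ideal_c_lcs Ic.
  rewrite (lie_iso_nil_type iso) quot_nil_type // n2_nil_type //; split=> //.
  by exists 4%N; rewrite // (lie_iso_nilindex _ iso) quot_nilindex ?lcs_freeNil.
Qed.

End N2.

(** * Every algebra of type 2 and nilindex at most 4 is listed *)

Section Ideals.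
Variables (F : fieldType) (nz2 : (2 : F) != 0).

Lemma n2_ideal_small t (J : {vspace n2 F t}) : (0 < t <= 2)%N ->
  is_ideal J -> (J <= lcs (n2 F t) 2)%VS -> ~~ (lcs (n2 F t) t <= J)%VS -> J = 0%VS.
Proof.
move=> t12 idJ J2 Jt; apply/eqP; rewrite -subv0; apply/subvP => u uJ.
have u2 := subvP J2 u uJ; rewrite -(lcs_freeNil F 'I_2 t).
case: t t12 J idJ J2 Jt u uJ u2 => [|[|[|]]] // _ J /idealP idJ J2 Jt u uJ u2.
have [c uc] := lcs2_genP (n2_generate F 2) u2.
move: uc; rewrite lcs_freeNil memv0 subr_eq0 => /eqP uE.
have [c0|c0] := eqVneq c 0; first by rewrite uE c0 scale0r mem0v.
case/negP: Jt; have := lcs2_gen (n2_generate F 2); rewrite lcs_freeNil addv0.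
move=> /subv_trans; apply; rewrite span_seq1 -memvE.
by apply: (scalev_mem c0); rewrite -uE.
Qed.

Lemma n2_3_ideal (J : {vspace n2 F 3}) :
  is_ideal J -> (J <= lcs (n2 F 3) 2)%VS -> ~~ (lcs (n2 F 3) 3 <= J)%VS ->
  J = 0%VS \/ ideal_b J.
Proof.
move=> /idealP idJ J2 J3n.
have J3 : (J <= lcs (n2 F 3) 3)%VS.
  apply/subvP => u uJ; have [c uc] := lcs2_genP (n2_generate F 3) (subvP J2 u uJ).
  have [c0|c0] := eqVneq c 0; first by move: uc; rewrite c0 scale0r subr0.
  case/negP: J3n; rewrite lcs_n2_3; apply/span_subvP => x.
  have step (y : n2 F 3) : lie y w0 \in J.
    apply: (scalev_mem c0); rewrite -lieZr -[c *: w0](subKr u) lieBr.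
    by apply: rpredB; [apply: idJ | apply: (@n2_lie_lcs_le _ 3 3)].
  by rewrite !inE => /orP[]/eqP->; apply: step.
have dJ : (\dim J < 2)%N.
  rewrite -[2%N in X in (_ < X)%N](dim_lcs_n2_3 F) ltn_neqAle dimvS // andbT.
  by rewrite (dimv_leqif_sup J3).
case dE: (\dim J) dJ => [|[|]] // _; last by right.
by left; apply/eqP; rewrite -dimv_eq0 dE.
Qed.

(** The algebra and its basis elements are abstracted first: vring is much slower
    on terms of the concrete type n2 F 4. *)
Ltac n2_vring F y1 :=
  generalize (@z0 F 4%N) (@z1 F 4%N) (@x0 F 4%N) y1 (@x2 F 4%N);
  generalize (n2 F 4%N); intros; vring.

(** Unless the ideal J lies in lcs 4, it contains p z0 + q z1 + ... with
    (p, q) <> (0, 0); the brackets of this element with v0 and v1 then span two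
    dimensions of lcs 4, all that J can contain of it, and normalizing the
    element according to p <> 0 or p = 0 gives the two families of
    3-dimensional ideals. *)
Lemma n2_4_ideal (J : {vspace n2 F 4}) :
  is_ideal J -> (J <= lcs (n2 F 4) 2)%VS -> ~~ (lcs (n2 F 4) 4 <= J)%VS ->
  J = 0%VS \/ ideal_c J.
Proof.
move=> /idealP idJ J2 J4n.
pose y1 : n2 F 4 := gx1 v0 v1.
have x1E : x1 = 2 *: y1 by [].
have l5 (m : n2 F 4) y : m \in lcs (n2 F 4) 4 -> lie y m = 0.
  move=> m4; apply/eqP; rewrite -memv0; exact: (@n2_lie_lcs_le _ 4 4).
have gen4 m : m \in lcs (n2 F 4) 4 -> exists c0 c1 c2, m = c0 *: x0 + c1 *: y1 + c2 *: x2.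
  move=> /(lcs4_genP (n2_generate F 4))[c0 [c1 [c2]]].
  rewrite lcs_freeNil memv0 subr_eq0 => /eqP ->; by exists c0, c1, c2.
have notall : [/\ x0 \in J, y1 \in J & x2 \in J] -> False.
  move=> [xJ0 xJ1 xJ2]; case/negP: J4n; apply/subvP => m /gen4[c0 [c1 [c2 ->]]].
  by rewrite !rpredD ?rpredZ.
have J3 : (J <= lcs (n2 F 4) 3)%VS.
  apply/subvP => u uJ; have [c uc] := lcs2_genP (n2_generate F 4) (subvP J2 u uJ).
  have [c0|c0] := eqVneq c 0; first by move: uc; rewrite c0 scale0r subr0.
  have step (y z : n2 F 4) : lie y (lie z w0) \in J.
    apply: (scalev_mem c0).
    have -> : c *: lie y (lie z w0) = lie y (lie z u) - lie y (lie z (u - c *: w0)).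
      by rewrite -!lieBr subKr !lieZr.
    apply: rpredB; first exact/idJ/idJ.
    by apply: (@n2_lie_lcs_le _ 4 4) => //; apply: mem_lcsS.
  by case: notall; split; apply: step.
have gen3 u : u \in J -> exists p q c0 c1 c2,
    u = p *: z0 + q *: z1 + (c0 *: x0 + c1 *: y1 + c2 *: x2).
  move=> /(subvP J3)/(lcs3_genP (n2_generate F 4))[p [q]].
  move=> /gen4[c0 [c1 [c2 uE]]]; exists p, q, c0, c1, c2.
  by rewrite -uE addrC subrK.
have x4 c0 c1 c2 : c0 *: x0 + c1 *: y1 + c2 *: x2 \in lcs (n2 F 4) 4.
  by rewrite !rpredD ?rpredZ ?gx0_lcs ?gx1_lcs ?gx2_lcs.
have br p q c0 c1 c2 : p *: z0 + q *: z1 + (c0 *: x0 + c1 *: y1 + c2 *: x2) \in J ->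
    p *: x0 + q *: y1 \in J /\ p *: y1 + q *: x2 \in J.
  move=> uJ; split.
    by have := idJ v0 _ uJ; rewrite lieDr (l5 _ v0 (x4 _ _ _)) addr0 lieDr !lieZr.
  have := idJ v1 _ uJ; rewrite lieDr (l5 _ v1 (x4 _ _ _)) addr0 lieDr !lieZr.
  by rewrite lie_v1_z0.
have [J4|J4] := boolP (J <= lcs (n2 F 4) 4)%VS.
  have dJ : (\dim J < 3)%N.
    rewrite -[3%N in X in (_ < X)%N](dim_lcs_n2_4 nz2) ltn_neqAle dimvS // andbT.
    by rewrite (dimv_leqif_sup J4).
  case dE: (\dim J) dJ => [|[|[|]]] // _.
  - by left; apply/eqP; rewrite -dimv_eq0 dE.
  - by right; apply: Ideal_c_i => //; left.
  - by right; apply: Ideal_c_i => //; right.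
right.
(* al and be normalize the element of J to z0 + al z1 + be x2, the other
   multiples of x0 and y1 being removed by the two brackets found in J. *)
have [[p [q [c0 [c1 [c2 [uJ p0]]]]]]|np] := pselect (exists p q c0 c1 c2,
    p *: z0 + q *: z1 + (c0 *: x0 + c1 *: y1 + c2 *: x2) \in J /\ p != 0).
  have [A0 B0] := br _ _ _ _ _ uJ.
  pose al := q / p.
  have qE : q = p * al by rewrite mulrC divfK.
  have AJ : x0 + al *: y1 \in J.
    by apply: (scalev_mem p0); rewrite scalerDr scalerA -qE.
  have BJ : y1 + al *: x2 \in J.
    by apply: (scalev_mem p0); rewrite scalerDr scalerA -qE.
  pose be := (c2 - al * (c1 - al * c0)) / p.
  have beE : c2 = p * be + al * (c1 - al * c0) by rewrite mulrC divfK // subrK.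
  have UJ : z0 + al *: z1 + be *: x2 \in J.
    apply: (scalev_mem p0).
    have -> : p *: (z0 + al *: z1 + be *: x2) =
       p *: z0 + q *: z1 + (c0 *: x0 + c1 *: y1 + c2 *: x2)
       - c0 *: (x0 + al *: y1) - (c1 - al * c0) *: (y1 + al *: x2).
      by rewrite qE beE; n2_vring F y1.
    by rewrite !rpredB ?rpredZ.
  apply: (Ideal_c_iii (alpha := al) (beta := be)).
  have -> : 2 *: x0 + al *: x1 = 2 *: (x0 + al *: y1) by rewrite x1E; n2_vring F y1.
  have -> : x1 + (2 * al) *: x2 = 2 *: (y1 + al *: x2) by rewrite x1E; n2_vring F y1.
  apply/eqP; rewrite eqEsubv; apply/andP; split; last first.
    apply/span_subvP => x; rewrite !inE => /or3P[]/eqP-> //; exact: rpredZ.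
  apply/subvP => y yJ; have [p' [q' [d0 [d1 [d2 yE]]]]] := gen3 y yJ.
  have y'J : 0 *: z0 + (q' - p' * al) *: z1 +
      (d0 *: x0 + d1 *: y1 + (d2 - p' * be) *: x2) \in J.
    have -> : 0 *: z0 + (q' - p' * al) *: z1 +
      (d0 *: x0 + d1 *: y1 + (d2 - p' * be) *: x2)
        = y - p' *: (z0 + al *: z1 + be *: x2) by rewrite yE; n2_vring F y1.
    by rewrite rpredB ?rpredZ.
  have [] := br _ _ _ _ _ y'J; rewrite !scale0r !add0r => e1 e2.
  have [dq|dq] := eqVneq (q' - p' * al) 0; last first.
    case: notall; have y1J := scalev_mem dq e1; split; last exact: scalev_mem dq e2.
      by rewrite -[x0](addrK (al *: y1)) rpredB ?rpredZ.
    exact: y1J.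
  pose ga := d2 - p' * be - al * (d1 - al * d0).
  have gaJ : ga *: x2 \in J.
    have -> : ga *: x2 = 0 *: z0 + (q' - p' * al) *: z1 +
      (d0 *: x0 + d1 *: y1 + (d2 - p' * be) *: x2)
      - d0 *: (x0 + al *: y1) - (d1 - al * d0) *: (y1 + al *: x2).
      by rewrite dq /ga; n2_vring F y1.
    by rewrite !rpredB ?rpredZ.
  have [ga0|ga0] := eqVneq ga 0; last first.
    have x2J := scalev_mem ga0 gaJ.
    have y1J : y1 \in J by rewrite -[y1](addrK (al *: x2)) rpredB ?rpredZ.
    case: notall; split=> //.
    by rewrite -[x0](addrK (al *: y1)) rpredB ?rpredZ.
  have -> : y = p' *: (z0 + al *: z1 + be *: x2)
      + (d0 / 2) *: (2 *: (x0 + al *: y1))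
      + ((d1 - al * d0) / 2) *: (2 *: (y1 + al *: x2)).
    have q'E : q' = p' * al by apply/eqP; rewrite -subr_eq0 dq.
    have d2E : d2 = p' * be + al * (d1 - al * d0).
      by apply/eqP; rewrite -subr_eq0 opprD addrA; apply/eqP.
    by rewrite yE !scalerA !divfK // q'E d2E; n2_vring F y1.
  by do 2?apply: rpredD; apply: rpredZ; apply: memv_span; rewrite !inE eqxx ?orbT.
have noz0 p q c0 c1 c2 :
    p *: z0 + q *: z1 + (c0 *: x0 + c1 *: y1 + c2 *: x2) \in J -> p = 0.
  by move=> uJ; apply/eqP/contraT => p0; case: np; exists p, q, c0, c1, c2.
have [u uJ u4] := subvPn J4.
have [p [q [c0 [c1 [c2 uE]]]]] := gen3 u uJ; rewrite uE in uJ u4.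
have p0 := noz0 _ _ _ _ _ uJ; rewrite p0 in uJ u4.
have q0 : q != 0.
  by apply: contraNneq u4 => ->; rewrite !scale0r !add0r x4.
have [] := br _ _ _ _ _ uJ; rewrite !scale0r !add0r.
move=> /(scalev_mem q0) y1J /(scalev_mem q0) x2J.
pose al := c0 / q.
have c0E : c0 = q * al by rewrite mulrC divfK.
have UJ : z1 + al *: x0 \in J.
  apply: (scalev_mem q0).
  have -> : q *: (z1 + al *: x0) = 0 *: z0 + q *: z1 + (c0 *: x0 + c1 *: y1 + c2 *: x2)
    - c1 *: y1 - c2 *: x2 by rewrite c0E; n2_vring F y1.
  by rewrite !rpredB ?rpredZ.
have x0J : x0 \notin J by apply/negP => x0J; apply: notall.
apply: (Ideal_c_ii (alpha := al)); rewrite x1E.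
apply/eqP; rewrite eqEsubv; apply/andP; split; last first.
  apply/span_subvP => x; rewrite !inE => /or3P[]/eqP-> //; exact: rpredZ.
apply/subvP => y yJ; have [p' [q' [d0 [d1 [d2 yE]]]]] := gen3 y yJ.
have p'0 : p' = 0 by apply: (noz0 p' q' d0 d1 d2); rewrite -yE.
have gaJ : (d0 - q' * al) *: x0 \in J.
  have -> : (d0 - q' * al) *: x0 = y - q' *: (z1 + al *: x0) - d1 *: y1 - d2 *: x2.
    by rewrite yE p'0; n2_vring F y1.
  by rewrite !rpredB ?rpredZ.
have ga0 : d0 - q' * al = 0.
  by apply/eqP/contraT => /scalev_mem/(_ gaJ); rewrite (negPf x0J).
have -> : y = q' *: (z1 + al *: x0) + (d1 / 2) *: (2 *: y1) + d2 *: x2.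
  have d0E : d0 = q' * al by apply/eqP; rewrite -subr_eq0 ga0.
  by rewrite yE p'0 scalerA divfK // d0E; n2_vring F y1.
by do 2?apply: rpredD; apply: rpredZ; apply: memv_span; rewrite !inE eqxx ?orbT.
Qed.

End Ideals.

Section Classification.
Variables (F : fieldType) (nz2 : (2 : F) != 0).

Lemma nilindex_hom (L : vectLieType F) t (a0 a1 : L) :
  nilindex L t -> generate2 a0 a1 ->
  exists f : {linear n2 F t -> L},
    [/\ lie_morph f, f v0 = a0, f v1 = a1 & limg (linfun f) = fullv].
Proof.
move=> /andP[_ /eqP Lt] gen.
have [f fm fE] := freeNil_lift (fun j : 'I_2 => if j == ord0 then a0 else a1) Lt.
have f0 : f v0 = a0 by rewrite fE.
have f1 : f v1 = a1 by rewrite fE.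
exists f; split=> //; apply: generate2_surj fm _ _ gen Lt;
  by rewrite -?f0 -?f1 -(lfunE f) memv_img ?memvf.
Qed.

(** L is the quotient of n2 F t by the kernel of the morphism onto it, an ideal
    inside lcs 2 that does not contain lcs t. *)
Lemma type_listed (L : vectLieType F) t : nil_type L = 2%N -> (t <= 4)%N ->
  nilindex L t -> listed L.
Proof.
move=> nt t4 ni; have [a0 [a1 [gen fr]]] := nil_type2_gens nt.
have [f [fm f0 f1 fs]] := nilindex_hom ni gen.
have t0 := nilindex_gt0 ni.
pose J := lker (linfun f); have JE : lker (linfun f) = J by [].
have idJ : is_ideal J by apply: lker_ideal.
have J2 : (J <= lcs (n2 F t) 2)%VS.
  apply/subvP => u; rewrite memv_ker lfunE /= => /eqP fu0.
  have [c0 [c1 uc]] := lcs1_genP (n2_generate F t) u.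
  have : c0 *: a0 + c1 *: a1 \in lcs L 2.
    by have := mem_lcs_morph fm uc; rewrite linearB fu0 sub0r memvN linearD !linearZ /= f0 f1.
  by move=> /fr[c00 c10]; move: uc; rewrite c00 c10 !scale0r addr0 subr0.
have Jt : ~~ (lcs (n2 F t) t <= J)%VS.
  by rewrite lkerE (limg_lcs fm) //; case/andP: ni.
have iso0 : J = 0%VS -> item_a L.
  by move=> J0; exists t; [rewrite t0 | apply: bij_iso fm fs J0].
case: t t4 ni f fm f0 f1 fs t0 J JE idJ J2 Jt iso0 => [|[|[|[|[|]]]]] // _ ni f fm f0 f1 fs _ J JE idJ J2 Jt iso0.
- by apply/Or31/iso0; apply: n2_ideal_small.
- by apply/Or31/iso0; apply: n2_ideal_small.
- case: (n2_3_ideal idJ J2 Jt) => [/iso0|Jb]; first exact: Or31.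
  apply: Or32; exists J => //; exists idJ.
  exact: (lie_quot_lker fm idJ fs JE).
- case: (n2_4_ideal nz2 idJ J2 Jt) => [/iso0|Jc]; first exact: Or31.
  apply: Or33; exists J => //; exists idJ.
  exact: (lie_quot_lker fm idJ fs JE).
Qed.

End Classification.

(** * Levi extensions of free nilpotent algebras *)

Section Derived.
Variables (F : fieldType).

Lemma limg_derived (L M : vectLieType F) (f : {linear L -> M}) k (U : {vspace L}) :
  lie_morph f -> (linfun f @: iter k (fun W => lie_prod W W) U
    = iter k (fun W => lie_prod W W) (linfun f @: U))%VS.
Proof. by move=> fm; elim: k => //= k IH; rewrite limg_lie_prod // IH. Qed.

Lemma derived_lcs (L : vectLieType F) k :
  (iter k (fun W => lie_prod W W) (fullv : {vspace L}) <= lcs L k.+1)%VS.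
Proof. by elim: k => //= k IH; rewrite lcsS lie_prodS ?subvf. Qed.

(** In dimension at most 2 all brackets are multiples of a single one, so a
    perfect subalgebra is zero. *)
Lemma perfect_dim_le2 (L : vectLieType F) (U : {vspace L}) :
  (\dim U <= 2)%N -> lie_prod U U = U -> U = 0%VS.
Proof.
move=> dU perf; suff [z Uz] : exists z, (U <= <[z]>)%VS.
  apply/eqP; rewrite -subv0 -perf; apply/lie_prod_subP => x y /(subvP Uz)/vlineP[a ->].
  by move=> /(subvP Uz)/vlineP[b ->]; rewrite lieZl lieZr liexx !scaler0 mem0v.
have := size_tuple (vbasis U); have := span_basis (vbasisP U).
case: (tval (vbasis U)) => [|x [|y [|? ?]]] US sU; last by rewrite -sU in dU.
- by exists 0; rewrite -US span_nil.
- by exists x; rewrite -US span_seq1.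
exists (lie x y); rewrite -{1}perf -US; apply: lie_prod_span => u v.
rewrite !inE => /orP[]/eqP-> /orP[]/eqP->; rewrite ?liexx ?mem0v ?memv_line //.
by rewrite lieC memvN memv_line.
Qed.

End Derived.

Section Sl2.
Variables (F : fieldType) (nz2 : (2 : F) != 0).
Notation gl2 := (glLie F 2).

(** The trace as a linear form on gl2, with sl2 its kernel. *)
Definition tracef : {linear gl2 -> F^o} := (mxtrace : {linear 'M[F]_2 -> F^o}).
Definition sl2_vs : {vspace gl2} := lker (linfun tracef).

Lemma sl2P (A : gl2) : (A \in sl2_vs) = (\tr (A : 'M_2) == 0).
Proof. by rewrite memv_ker lfunE. Qed.

Lemma gl_lieE (A B : gl2) : lie A B = (A : 'M_2) *m B - (B : 'M_2) *m A.
Proof. by []. Qed.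

Lemma tr_gl_lie (A B : gl2) : lie A B \in sl2_vs.
Proof. by rewrite sl2P gl_lieE linearB /= mxtrace_mulC subrr. Qed.

Lemma sl2_subalgebra : is_subalgebra sl2_vs.
Proof. by apply/lie_prod_subP => A B _ _; apply: tr_gl_lie. Qed.

(** The raising and lowering matrices, and their bracket. *)
Definition slE : gl2 := delta_mx ord0 ord_max.
Definition slF : gl2 := delta_mx ord_max ord0.
Definition slH : gl2 := lie slE slF.

Lemma mx2P (A B : 'M[F]_2) : A ord0 ord0 = B ord0 ord0 ->
  A ord0 ord_max = B ord0 ord_max -> A ord_max ord0 = B ord_max ord0 ->
  A ord_max ord_max = B ord_max ord_max -> A = B.
Proof.
move=> h00 h01 h10 h11; apply/matrixP => i j.
have two (k : 'I_2) : k = ord0 \/ k = ord_max.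
  by case: k => [[|[|//]] k2]; [left|right]; apply: val_inj.
by case: (two i) => ->; case: (two j) => ->.
Qed.

Lemma sum2 (V : nmodType) (g : 'I_2 -> V) : \sum_i g i = g ord0 + g ord_max.
Proof. by rewrite big_ord_recl big_ord1; congr (_ + g _); apply: val_inj. Qed.

Lemma sl2_slE : slE \in sl2_vs. Proof. by rewrite sl2P /mxtrace sum2 !mxE /= addr0. Qed.
Lemma sl2_slF : slF \in sl2_vs. Proof. by rewrite sl2P /mxtrace sum2 !mxE /= addr0. Qed.

Lemma slEH : lie slE slH = - 2 *: slE.
Proof. by apply: mx2P; rewrite !mxE !sum2 !mxE !sum2 !mxE /=; ring. Qed.
Lemma slFH : lie slF slH = 2 *: slF.
Proof. by apply: mx2P; rewrite !mxE !sum2 !mxE !sum2 !mxE /=; ring. Qed.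

Lemma sl2_decomp (A : gl2) : A \in sl2_vs ->
  A = (A : 'M_2) ord0 ord_max *: slE + (A : 'M_2) ord_max ord0 *: slF
      + (A : 'M_2) ord0 ord0 *: slH.
Proof.
rewrite sl2P /mxtrace sum2 addrC addr_eq0 => /eqP tr0.
by apply: mx2P; rewrite ?tr0 !mxE !sum2 !mxE /=; ring.
Qed.

Lemma dim_sl2 : (\dim sl2_vs <= 3)%N.
Proof.
apply: leq_trans (dim_span [:: slE; slF; slH]); apply: dimvS.
apply/subvP => A /sl2_decomp ->.
by rewrite !rpredD ?rpredZ // memv_span ?inE ?eqxx ?orbT.
Qed.

(** sl2 is simple: raising twice a nonzero element of an ideal gives a multiple
    of slE, whose brackets generate everything. *)
Lemma sl2_simple (J : {vspace gl2}) : (J <= sl2_vs)%VS ->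
  (forall A B, A \in sl2_vs -> B \in J -> lie A B \in J) -> J != 0%VS -> J = sl2_vs.
Proof.
move=> Jsl Jid J0; apply/eqP; rewrite eqEsubv Jsl /=.
have nz2' : - 2 != 0 :> F by rewrite oppr_eq0.
have adE B : B \in J -> lie slE B \in J by apply: Jid; apply: sl2_slE.
have adF B : B \in J -> lie slF B \in J by apply: Jid; apply: sl2_slF.
suff EJ : slE \in J.
  have HJ : slH \in J by rewrite /slH lieC memvN adF.
  have FJ : slF \in J by apply: (scalev_mem nz2); rewrite -slFH adF.
  by apply/subvP => A /sl2_decomp ->; rewrite !rpredD ?rpredZ.
have : vpick J != 0 by rewrite vpick0.
have := memv_pick J; move: (vpick J) => A AJ A0.
have Ad := sl2_decomp (subvP Jsl A AJ).
set a := (A : 'M_2) _ _ in Ad; set b := (A : 'M_2) _ _ in Ad; set c := (A : 'M_2) _ _ in Ad.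
have EA : lie slE A = b *: slH + (c * - 2) *: slE.
  by rewrite {1}Ad !lieDr !lieZr liexx slEH scaler0 add0r scalerA.
have EEA : lie slE (lie slE A) = (b * - 2) *: slE.
  by rewrite EA lieDr !lieZr liexx slEH scaler0 addr0 scalerA.
have [b0|b0] := eqVneq b 0; last first.
  apply: (@scalev_mem _ _ _ (b * - 2)); first by rewrite mulf_neq0.
  by rewrite -EEA !adE.
have [c0|c0] := eqVneq c 0; last first.
  apply: (@scalev_mem _ _ _ (c * - 2)); first by rewrite mulf_neq0.
  by have := adE A AJ; rewrite EA b0 scale0r add0r.
have AaE : A = a *: slE by rewrite {1}Ad b0 c0 !scale0r !addr0.
apply: (@scalev_mem _ _ _ a); last by rewrite -AaE.
by apply: contraNneq A0 => a0; rewrite AaE a0 scale0r.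
Qed.

Lemma sl2_neq0 : sl2_vs != 0%VS.
Proof.
apply/eqP => s0; have := sl2_slE; rewrite s0 memv0 => /eqP/matrixP/(_ ord0 ord_max).
by rewrite !mxE !eqxx => /eqP; rewrite oner_eq0.
Qed.

Lemma sl2_perfect : lie_prod sl2_vs sl2_vs = sl2_vs.
Proof.
apply: sl2_simple; first exact: sl2_subalgebra.
  by move=> A B As Bs; rewrite mem_lie_prod // (subvP sl2_subalgebra).
apply/eqP => l0; have := mem_lie_prod sl2_slF (tr_gl_lie slE slF).
rewrite -/slH slFH l0 memv0 scaler_eq0 (negPf nz2) /= => /eqP/matrixP/(_ ord_max ord0).
by rewrite !mxE !eqxx => /eqP; rewrite oner_eq0.
Qed.

(** For a morphism p onto sl2 under which S covers sl2, any solvable S-stable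
    subspace lies in the kernel of p: its image is an ideal of sl2, and the
    derived series of sl2 is constant.  With S = L this bounds the radical,
    with S a complement of the kernel it shows that S is semisimple. *)
Lemma sl2_solvable_stable (L : vectLieType F) (p : {linear L -> gl2}) (S J : {vspace L}) :
  lie_morph p -> (linfun p @: fullv <= sl2_vs)%VS -> (sl2_vs <= linfun p @: S)%VS ->
  (lie_prod S J <= J)%VS -> solvable J -> (J <= lker (linfun p))%VS.
Proof.
move=> pm psl Ssl SJ [k Jk]; rewrite lkerE; apply/contraT => J0.
have Jsl : (linfun p @: J)%VS = sl2_vs.
  apply: sl2_simple J0; first by apply: subv_trans psl; rewrite limgS ?subvf.
  move=> A B /(subvP Ssl) Ap Bp; apply: (subvP (limgS (linfun p) SJ)).
  by rewrite limg_lie_prod // mem_lie_prod.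
have := limg_derived k J pm; rewrite Jk limg0 Jsl.
have -> : iter k (fun W => lie_prod W W) sl2_vs = sl2_vs.
  by elim: (k) => //= i ->; apply: sl2_perfect.
by move=> /esym/eqP; rewrite (negPf sl2_neq0).
Qed.

Section Extension.
Variable t : nat.
Hypothesis t0 : (0 < t)%N.
Notation N := (n2 F t).
Notation sl2 := (subLie sl2_subalgebra).

Let sv : sl2 -> gl2 := sub_val sl2_subalgebra.

Fact sl2_act_linear x : linear (fun a : sl2 => gl_der t (sv a) x).
Proof. by move=> c a b; rewrite /sv linearP; apply: (@gl_der_linear F 2 t x). Qed.
Fact sl2_act_lie (a b : sl2) x :
  gl_der t (sv (lie a b)) x = gl_der t (sv a) (gl_der t (sv b) x) - gl_der t (sv b) (gl_der t (sv a) x).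
Proof. by rewrite /sv sub_val_morph; apply: gl_der_lie. Qed.

(** sl2 acting on n2 F t through its matrices on the generators. *)
Definition sl2_action : lieAction sl2 N :=
  @LieAction F sl2 N (fun a => gl_der t (sv a)) sl2_act_linear
    (fun a => gl_der_der (sv a)) sl2_act_lie.

Notation g := (semidirect sl2_action).

(* The semidirect product with its projection to sl2 and its two factors. *)
Local Definition ext_proj (u : g) : gl2 := sv u.1.
Fact ext_proj_linear : linear ext_proj.
Proof. by move=> a u v; apply: (linearP (sub_val sl2_subalgebra)). Qed.
HB.instance Definition _ := GRing.isLinear.Build F g gl2 *:%R ext_proj ext_proj_linear.
Local Definition ext_rad (x : N) : g := (0, x).
Fact ext_rad_linear : linear ext_rad.
Proof. by move=> a x y; congr (_, _); rewrite /= scaler0 addr0. Qed.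
HB.instance Definition _ := GRing.isLinear.Build F N g *:%R ext_rad ext_rad_linear.
Local Definition ext_levi (a : sl2) : g := (a, 0).
Fact ext_levi_linear : linear ext_levi.
Proof. by move=> a x y; congr (_, _); rewrite /= scaler0 addr0. Qed.
HB.instance Definition _ := GRing.isLinear.Build F sl2 g *:%R ext_levi ext_levi_linear.

(** The semidirect product of sl2 and n2 F t is a nontrivial Levi extension. *)
Lemma n2_levi : nontrivial_levi_ext N.
Proof.
have pm : lie_morph ext_proj by move=> u v; rewrite /ext_proj sd_lieE /= /sv sub_val_morph.
have act0 (x : N) : sl2_action 0 x = 0.
  by have /= := lie_act_linear sl2_action x (-1) 0 0; rewrite scaler0 addr0 scaleN1r addNr.
have im : lie_morph ext_rad.
  by move=> x y; rewrite sd_lieE /= !act0 subr0 add0r lie0l.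
have jm : lie_morph ext_levi.
  by move=> a b; rewrite sd_lieE /= !linear0 ?subr0 ?lie0l !addr0.
have kerp : lker (linfun ext_proj) = limg (linfun ext_rad).
  apply/vspaceP => u; rewrite memv_ker lfunE /=; apply/eqP/memv_imgP.
    case: u => a x; rewrite /ext_proj /= => a0; exists x; rewrite ?memvf // lfunE /= /ext_rad.
    by congr (_, _); apply: (sub_val_inj sl2_subalgebra); rewrite [LHS]a0 linear0.
  by move=> [x _ ->]; rewrite lfunE; apply: (linear0 (sub_val sl2_subalgebra)).
have ppsl : (linfun ext_proj @: fullv <= sl2_vs)%VS.
  apply/subvP => _ /memv_imgP[u _ ->]; rewrite lfunE /= /ext_proj.
  exact: subvsP.
have pS : (sl2_vs <= linfun ext_proj @: limg (linfun ext_levi))%VS.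
  apply/subvP => A Asl; pose a : sl2 := vsproj sl2_vs A.
  apply/memv_imgP; exists (ext_levi a); last by rewrite lfunE /= /ext_proj /= [RHS]vsprojK.
  by rewrite -(lfunE ext_levi) memv_img ?memvf.
exists g, ext_rad; split.
- by move=> x y [].
- exact: im.
- split.
  + by rewrite -kerp; apply: lker_ideal.
  + exists t; rewrite -(limg_derived t fullv im); apply/eqP; rewrite -subv0.
    by apply: subv_trans (limgS _ (derived_lcs _ _)) _; rewrite lcs_freeNil limg0.
  + move=> J idJ solJ; rewrite -kerp.
    apply: (@sl2_solvable_stable _ _ fullv) => //.
    by apply: subv_trans pS _; rewrite limgS ?subvf.
exists (limg (linfun ext_levi)); first split.
- rewrite /is_subalgebra -limg_lie_prod // limgS ?subvf //.
- move=> J Js sJ solJ.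
  have := sl2_solvable_stable pm ppsl pS sJ solJ; rewrite kerp => Ji.
  apply/eqP; rewrite -subv0; apply/subvP => u uJ.
  have /memv_imgP[a _ ua] := subvP Js u uJ; have /memv_imgP[x _ ux] := subvP Ji u uJ.
  have a0 : 0 = a by have := congr1 fst ua; rewrite ux !lfunE.
  by rewrite ua -a0 linear0 mem0v.
- apply/vspaceP => -[a x]; rewrite memvf.
  have -> : (a, x) = ext_levi a + ext_rad x :> g by congr (_, _); rewrite /= ?addr0 ?add0r.
  by rewrite -(lfunE ext_levi) -(lfunE ext_rad) memv_add ?memv_img ?memvf.
- apply/eqP; rewrite -subv0; apply/subvP => u /memv_capP[/memv_imgP[a _ ->] /memv_imgP[x _]].
  by rewrite !lfunE /= /ext_rad /ext_levi => -[-> _]; rewrite memv0.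
apply/eqP => l0.
have /memv_imgP[e _] : slE \in limg (linfun (sub_val sl2_subalgebra)).
  by rewrite limg_sub_val sl2_slE.
rewrite lfunE => eE.
have : lie (ext_levi e) (ext_rad v1) \in lie_prod (limg (linfun ext_levi)) (limg (linfun ext_rad)).
  by rewrite -(lfunE ext_levi) -(lfunE ext_rad) mem_lie_prod ?memv_img ?memvf.
rewrite l0 memv0 => /eqP/(congr1 snd) /=.
rewrite lie0l linear0 subr0 addr0 /sv -eE gl_der_gen sum2 !mxE /= scale1r scale0r addr0.
move=> v00; have [] := @n2_gens_free F t 1 0 t0; last by move/eqP; rewrite oner_eq0.
by rewrite scale1r scale0r addr0 [v0]v00 mem0v.
Qed.

End Extension.

Lemma levi_ext_iso (L M : vectLieType F) : lie_iso L M ->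
  nontrivial_levi_ext M -> nontrivial_levi_ext L.
Proof.
move=> [h [h' hK h'K] hm] [g [f [fi fm rad lev]]].
have E : limg (linfun (f \o h)) = limg (linfun f).
  apply/vspaceP => u; apply/memv_imgP/memv_imgP => -[x _ ->].
    by exists (h x); rewrite ?memvf // !lfunE.
  by exists (h' x); rewrite ?memvf // !lfunE /= h'K.
exists g, (f \o h : {linear _ -> _}); rewrite E; split=> //.
  exact: inj_comp fi (can_inj hK).
by move=> x y /=; rewrite hm fm.
Qed.

End Sl2.

(** * Nontrivial Levi extensions force freeness *)

Section Levels.
Variables (F : fieldType) (nz2 : (2 : F) != 0).

(** With raising and lowering derivations on L, the morphism from n2 F t is
    injective: its kernel is trapped in lcs 2, lcs 3, ... one layer after the
    other. *)
Lemma hom_n2_injective (L : vectLieType F) t (a0 a1 : L) (f : {linear n2 F t -> L}) :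
  (t <= 4)%N -> nilindex L t -> generate2 a0 a1 -> free_mod2 a0 a1 ->
  sl2_pair a0 a1 -> lie_morph f -> f v0 = a0 -> f v1 = a1 ->
  lker (linfun f) = 0%VS.
Proof.
move=> t4 ni gen fr pair fm f0 f1; have t0 := nilindex_gt0 ni.
have ne k : (0 < k <= t)%N -> lcs L k.+1 <> lcs L k by apply: nilindex_lcs.
have fW : f w0 = gw a0 a1 by rewrite /w0 fm f0 f1.
have fZ0 : f z0 = gz0 a0 a1 by rewrite /z0 fm fW f0.
have fZ1 : f z1 = gz1 a0 a1 by rewrite /z1 fm fW f1.
have fX0 : f (gx0 v0 v1) = gx0 a0 a1 by rewrite /gx0 fm [f (gz0 _ _)]fZ0 f0.
have fX1 : f (gx1 v0 v1) = gx1 a0 a1 by rewrite /gx1 fm [f (gz1 _ _)]fZ1 f0.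
have fX2 : f (gx2 v0 v1) = gx2 a0 a1 by rewrite /gx2 fm [f (gz1 _ _)]fZ1 f1.
have gn := n2_generate F t.
have sub k (u m : n2 F t) : f u = 0 -> u - m \in lcs (n2 F t) k -> f m \in lcs L k.
  by move=> fu /(mem_lcs_morph fm); rewrite linearB fu sub0r memvN.
apply/eqP; rewrite -subv0; apply/subvP => u; rewrite memv_ker lfunE /= => /eqP fu.
have u2 : u \in lcs (n2 F t) 2.
  have [c0 [c1 uc]] := lcs1_genP gn u.
  have := sub _ _ _ fu uc; rewrite linearD !linearZ /= f0 f1 => /fr[c00 c10].
  by move: uc; rewrite c00 c10 !scale0r addr0 subr0.
have last k : (t < k)%N -> u \in lcs (n2 F t) k -> u \in 0%VS.
  by move=> tk; rewrite -(lcs_freeNil F 'I_2 t); apply/subvP/lcs_sub.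
have [tk|t2] := ltnP t 2; first exact: last tk u2.
have u3 : u \in lcs (n2 F t) 3.
  have [c uc] := lcs2_genP gn u2.
  have := sub _ _ _ fu uc; rewrite linearZ /= fW => /(gw_indep gen (ne 2%N t2)) c0.
  by move: uc; rewrite c0 scale0r subr0.
have [tk|t3] := ltnP t 3; first exact: last tk u3.
have u4 : u \in lcs (n2 F t) 4.
  have [c0 [c1 uc]] := lcs3_genP gn u3.
  have := sub _ _ _ fu uc; rewrite linearD !linearZ /= fZ0 fZ1.
  move=> /(gz_indep gen pair (ne 3%N t3))[c00 c10].
  by move: uc; rewrite c00 c10 !scale0r addr0 subr0.
have [tk|t4'] := ltnP t 4; first exact: last tk u4.
apply: (last 5%N) => //.
have [c0 [c1 [c2 uc]]] := lcs4_genP gn u4.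
have := sub _ _ _ fu uc; rewrite !linearD !linearZ /= fX0 fX1 fX2.
move=> /(gx_indep nz2 gen pair (ne 4%N t4'))[c00 c10 c20].
by move: uc; rewrite c00 c10 c20 !scale0r !addr0 subr0.
Qed.

End Levels.

Section DerMatrix.
Variables (F : fieldType) (L : vectLieType F) (a0 a1 : L).
Hypotheses (gen : generate2 a0 a1) (fr : free_mod2 a0 a1).

(** The two generators as a family. *)
Definition gens (j : 'I_2) := if j == ord0 then a0 else a1.

(** A is the matrix of D on the span of a0, a1 modulo lcs 2. *)
Definition represents (A : 'M[F]_2) (D : L -> L) :=
  forall j, D (gens j) - \sum_i A i j *: gens i \in lcs L 2.

Lemma gens_sum (c : 'I_2 -> F) : \sum_i c i *: gens i = c ord0 *: a0 + c ord_max *: a1.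
Proof. by rewrite sum2. Qed.

Lemma represents_uniq A B D : represents A D -> represents B D -> A = B.
Proof.
move=> AD BD.
have AB j : \sum_i (A i j - B i j) *: gens i \in lcs L 2.
  have := rpredB (BD j) (AD j); rewrite opprB addrC -addrA [- _ + _]addrC addrA.
  rewrite addrAC !addrA.
  have -> : \sum_i A i j *: gens i - D (gens j) + D (gens j) - \sum_i B i j *: gens i
    = \sum_i (A i j - B i j) *: gens i.
    by rewrite subrK -sumrB; apply: eq_bigr => i _; rewrite scalerBl.
  by [].
by apply: mx2P; have := AB ord0; have := AB ord_max; rewrite !gens_sum => /fr[h1 h2] /fr[h3 h4];
  apply/eqP; rewrite -subr_eq0; apply/eqP.
Qed.

Lemma represents_ex D : exists A, represents A D.
Proof.
have [p [q Dpq]] := lcs1_genP gen (D a0); have [r [s Drs]] := lcs1_genP gen (D a1).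
exists (\matrix_(i, j) if j == ord0 then (if i == ord0 then p else q)
                       else (if i == ord0 then r else s)) => j.
by rewrite gens_sum !mxE /= /gens; case: (j == ord0).
Qed.

Lemma represents_linear c A B (D D' : L -> L) : represents A D -> represents B D' ->
  represents (c *: A + B) (fun x => c *: D x + D' x).
Proof.
move=> AD BD j; have := rpredD (memvZ c (AD j)) (BD j).
rewrite scalerBr addrACA -opprD scaler_sumr -big_split /=.
by under eq_bigr do rewrite scalerA -scalerDl; under [in X in _ -> X]eq_bigr do rewrite !mxE.
Qed.

Lemma represents_comp A B (D D' : {linear L -> L}) : derivation D ->
  represents A D -> represents B D' -> represents (A *m B) (D \o D').
Proof.
move=> dD AD BD j.
have h1 := der_lcs dD (BD j); rewrite linearB linear_sum /= in h1.
have h2 : \sum_i B i j *: (D (gens i) - \sum_k A k i *: gens k) \in lcs L 2.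
  by rewrite rpred_sum // => i _; rewrite rpredZ // AD.
have := rpredD h1 h2; rewrite [X in X \in _](_ : _ = (D \o D') (gens j) - \sum_i (A *m B) i j *: gens i) //.
under eq_bigr do rewrite linearZ /=.
under [X in _ + X]eq_bigr do rewrite scalerBr.
rewrite sumrB addrA subrK /=; congr (_ - _).
under eq_bigr do rewrite scaler_sumr.
rewrite exchange_big /=; apply: eq_bigr => k _.
rewrite mxE scaler_suml; apply: eq_bigr => i _.
by rewrite scalerA mulrC.
Qed.

End DerMatrix.

Section LeviToFree.
Variables (C : numClosedFieldType).
Let nz2 : (2 : C) != 0. Proof. by rewrite pnatr_eq0. Qed.

(** The Levi factor s acts on L by derivations D, hence by a perfect subalgebra
    m of sl2 on L modulo lcs 2.  If m = 0 then s raises the lower central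
    series; as s is perfect it raises it arbitrarily far, so it acts trivially
    on the radical.  Otherwise m = sl2 contains the raising and lowering
    matrices, and L is free nilpotent by hom_n2_injective. *)
Theorem levi_ext_item_a (L : vectLieType C) t : nil_type L = 2%N -> (t <= 4)%N ->
  nilindex L t -> nontrivial_levi_ext L -> item_a L.
Proof.
move=> nt t4 ni [g [f [finj fm [rid _ _] [s [ssub sss _ _] srn0]]]].
have [a0 [a1 [gen fr]]] := nil_type2_gens nt.
pose r := limg (linfun f).
have spf : lie_prod s s = s by apply: semisimple_perfect.
pose D (d : g) : 'End(L) := ((linfun f)^-1 \o (linfun (lie d) \o linfun f))%VF.
have fD d x : f (D d x) = lie d (f x).
  rewrite /D !comp_lfunE -(lfunE f) limg_lfunVK ?lfunE //=.
  by apply: (idealP _ rid); rewrite -(lfunE f) memv_img ?memvf.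
have dD d : derivation (D d : {linear L -> L}).
  by move=> x y; apply: finj; rewrite fD fm linearD /= !fm !fD -lie_leibniz.
have Dlin c d e x : D (c *: d + e) x = c *: D d x + D e x.
  by apply: finj; rewrite linearP /= !fD lieDl lieZl.
have Dlie d e x : D (lie d e) x = D d (D e x) - D e (D d x).
  by apply: finj; rewrite linearB /= !fD (lie_leibniz d e) addrK.
have [M MD] := choice (fun d => represents_ex gen (D d)).
have Mlin : linear (M : g -> glLie C 2).
  move=> c d e; apply: (represents_uniq fr (MD _)).
  have := represents_linear c (MD d) (MD e).
  by congr represents; apply/funext => x; rewrite Dlin.
pose ML : {linear g -> glLie C 2} :=
  HB.pack (M : g -> glLie C 2) (GRing.isLinear.Build C g (glLie C 2) *:%R _ Mlin).
have Mm : lie_morph ML.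
  move=> d e; apply: (represents_uniq fr (MD _)).
  have := represents_linear (-1) (represents_comp (dD e) (MD e) (MD d))
                                 (represents_comp (dD d) (MD d) (MD e)).
  rewrite scaleN1r addrC; congr represents; apply/funext => x /=.
  by rewrite scaleN1r addrC Dlie.
pose m := (linfun ML @: s)%VS.
have mp : lie_prod m m = m by rewrite /m -limg_lie_prod // spf.
have msl : (m <= sl2_vs C)%VS.
  by rewrite -mp; apply/lie_prod_subP => A B _ _; apply: tr_gl_lie.
(* m is zero if its dimension is at most 2, and all of sl2 otherwise. *)
have [dm|dm] := leqP (\dim m) 2.
  have m0 := perfect_dim_le2 dm mp; case/eqP: srn0.
  have D2 d x : d \in s -> D d x \in lcs L 2.
    move=> ds.
    have M0 : M d = 0.
      apply/eqP; have : ML d \in m by rewrite -(lfunE ML) memv_img.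
      by rewrite m0 memv0.
    have [c0 [c1 xc]] := lcs1_genP gen x.
    have Dg j : D d (gens a0 a1 j) \in lcs L 2.
      have := MD d j; rewrite M0 big1 ?subr0 // => i _.
      by rewrite mxE scale0r.
    rewrite -[x](subrK (c0 *: a0 + c1 *: a1)) linearD rpredD //.
      exact: (der_lcs (dD d)).
    by rewrite linearD !linearZ /= rpredD ?rpredZ //; [apply: (Dg ord0)|apply: (Dg ord_max)].
  have Dk d k x : d \in s -> x \in lcs L k.+1 -> D d x \in lcs L k.+2.
    move=> ds; elim: k x => [|k IH] x; first by move=> _; apply: D2.
    rewrite lcsS; move: x; apply: lie_prod_ind => [|c x y xk yk|x y _ yk].
    - by rewrite linear0 mem0v.
    - by rewrite linearP rpredD ?rpredZ.
    rewrite (dD d) rpredD //; first by apply: lcs2_lie => //; apply: D2.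
    by apply: mem_lcsS; apply: IH.
  have Dj j d x : d \in s -> D d x \in lcs L j.+2.
    elim: j d x => [|j IH] d x; first exact: D2.
    rewrite -{1}spf; move: d; apply: lie_prod_ind => [|c d e dj ej|d e ds es].
    - by apply: (subvP (sub0v _)); rewrite memv0; apply/eqP/finj; rewrite fD lie0l linear0.
    - by rewrite Dlin rpredD ?rpredZ.
    - by rewrite Dlie rpredB // Dk // IH.
  apply/eqP; rewrite -subv0; apply/lie_prod_subP => d _ ds /memv_imgP[x _ ->].
  rewrite lfunE /= -fD; have /andP[_ /eqP Lt] := ni.
  have : D d x \in lcs L t.+1 by apply: (subvP (lcs_subS L t.+1)); apply: Dj.
  by rewrite Lt memv0 => /eqP->; rewrite linear0 mem0v.
have mE : m = sl2_vs C.
  by apply/eqP; rewrite eqEdim msl (leq_trans (dim_sl2 C)).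
have /memv_imgP[e es eE] : slE C \in m by rewrite mE sl2_slE.
have /memv_imgP[h hs hE] : slF C \in m by rewrite mE sl2_slF.
have pair : sl2_pair a0 a1.
  exists (D e : {linear L -> L}), (D h : {linear L -> L}).
  have {}eE : M e = delta_mx ord0 ord_max by move: eE; rewrite lfunE.
  have {}hE : M h = delta_mx ord_max ord0 by move: hE; rewrite lfunE.
  have := (MD e ord0, MD e ord_max, MD h ord0, MD h ord_max).
  rewrite !gens_sum eE hE !mxE /= /gens /= !(scale0r, scale1r, addr0, add0r, subr0).
  by move=> [[[e0 e1] h0] h1]; split; [exact: dD | exact: dD | split | split].
have [f' [f'm f'0 f'1 f's]] := nilindex_hom ni gen.
exists t; first by rewrite (nilindex_gt0 ni).
apply: (bij_iso f'm f's); exact: (hom_n2_injective nz2 t4 ni gen fr pair f'm f'0 f'1).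
Qed.

End LeviToFree.

Theorem corollary2p4 (R : realType) :
  [/\ lcs (n2 R[i] 3) 3 = span [:: z0; z1]
      /\ lcs (n2 R[i] 4) 4 = span [:: x0; x1; x2],
      (forall I : {vspace n2 R[i] 3}, ideal_b I -> is_ideal I)
      /\ (forall I : {vspace n2 R[i] 4}, ideal_c I -> is_ideal I),
      forall L : vectLieType R[i],
        (nil_type L = 2%N /\ exists2 t : nat, (t <= 4)%N & nilindex L t)
        <-> listed L
    & forall L : vectLieType R[i],
        listed L -> (nontrivial_levi_ext L <-> item_a L)].
Proof.
have nz2 : (2 : R[i]) != 0 by rewrite pnatr_eq0.
split.
- by split; [apply: lcs_n2_3 | apply: lcs_n2_4].
- by split=> I; [case/ideal_b_lcs | case/(ideal_c_lcs nz2)].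
- move=> L; split=> [[nt [t t4 ni]]|]; first exact: type_listed nt t4 ni.
  exact: listed_type.
move=> L lL; have [nt [t t4 ni]] := listed_type nz2 lL; split.
  exact: levi_ext_item_a nt t4 ni.
move=> [t' /andP[t'0 _] iso]; apply: levi_ext_iso iso _.
exact: n2_levi.
Qed.
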